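(* Let $\mathbf X_N=(X_j)_{j\in J}$ be a family of independent complex Wigner matrices whose entries have the same law as their complex conjugates, and let $(\alpha_j,\beta_j)$ be the parameter of $X_j$. Then $\mathbf X_N$ has a limiting traffic distribution. More precisely, for any test graph $T=(V,E,\gamma)$ in variables $\mathbf x=(x_j)_{j\in J}$, $$\tau_N^0\big[T(\mathbf X_N)\big]\longrightarrow_{N\to\infty}\mathbf 1\big(T\text{ is a colored double tree}\big)\prod_{j\in J}\alpha_j^{\ell_j(T)}\beta_j^{k_j(T)}.$$
   Context: A complex Wigner matrix is a Hermitian matrix $X_N=(x_{i,j}/\sqrt N)_{i,j}$ whose sub-diagonal entries (diagonal included) are independent and centered, the diagonal entries being identically distributed, the strictly sub-diagonal entries being identically distributed, the laws of the $x_{i,j}$ not depending on $N$ and having finite moments of all orders. Its parameter is the common value $(\alpha,\beta)=(\mathbb E[|x_{i,j}|^2],\mathbb E[x_{i,j}^2])$ for $i\ne j$. A test graph in $\mathbf x$ is $T=(V,E,\gamma)$ where $(V,E)$ is a finite connected directed graph (loops and multiple edges allowed, $V\neq\emptyset$) and $\gamma:E\to J$ labels edge $e$ by $x_{\gamma(e)}$. For matrices $\mathbf A_N=(A_j)_{j\in J}$, $$\tau_N^0[T(\mathbf A_N)]=\mathbb E\Big[\frac1N\sum_{\phi:V\to\{1,\dots,N\}\text{ injective}}\ \prod_{e=(v,w)\in E}A_{\gamma(e)}(\phi(w),\phi(v))\Big],$$ where $e=(v,w)$ goes from $v$ to $w$. Convergence in traffic distribution is, for Hermitian matrices, the pointwise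 convergence of $T\mapsto\tau_N^0[T(\mathbf A_N)]$ over all test graphs (equivalently of the same functional with the sum over all maps $\phi$). $T$ is a fat tree if it becomes a tree when multiplicity and orientation of edges are forgotten; it is a double tree if moreover the multiplicity of each edge is exactly two (orientation disregarded). Twin edges of a double tree are two edges with the same pair of endpoints. A double tree is colored if twin edges $e,e'$ always satisfy $\gamma(e)=\gamma(e')$. For a colored double tree, $\ell_j(T)$ (resp. $k_j(T)$) is the number of pairs of twin edges labeled $x_j$ with opposite (resp. same) orientation. *)

(* Defs.v *)
From HB Require Import structures.
From mathcomp Require Import all_boot all_order all_algebra.
From mathcomp Require Import complex.
From mathcomp Require Import all_classical all_reals all_analysis.

Set Implicit Arguments.
Unset Strict Implicit.
Unset Printing Implicit Defensive.

Import Order.TTheory GRing.Theory Num.Theory.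
Import numFieldNormedType.Exports.

Local Open Scope ring_scope.
Local Open Scope complex_scope.

(* Test graphs: [V] and [E] are the vertex and edge sets; an edge [e] goes from
   [src e] to [tgt e], so that loops and multiple edges are allowed. *)

Definition undirected_adj (V E : finType) (src tgt : E -> V) : rel V :=
  fun v w => [exists e, ((src e == v) && (tgt e == w)) ||
                        ((src e == w) && (tgt e == v))].

Record test_graph (J : Type) := TestGraph {
  tg_vertex : finType;
  tg_edge : finType;
  tg_src : tg_edge -> tg_vertex;
  tg_tgt : tg_edge -> tg_vertex;
  tg_label : tg_edge -> J;
  tg_nonempty : (0 < #|tg_vertex|)%N;
  tg_connected : forall v w, connect (undirected_adj tg_src tg_tgt) v w }.

Section TestGraphs.
Variable J : eqType.
Implicit Type T : test_graph J.

Definition tg_adj T : rel (tg_vertex T) := undirected_adj (@tg_src J T) (@tg_tgt J T).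

(* [e] is symmetric when it comes from an undirected graph; a loop is a cycle,
   whereas the closed walk v, w, v through a single edge is not one. *)
Definition is_tree (V : finType) (e : rel V) : Prop :=
  [/\ forall v w, connect e v w,
      irreflexive e
    & forall c : seq V, cycle e c -> uniq c -> (size c <= 2)%N].

Definition same_orientation T (e e' : tg_edge T) : bool :=
  (tg_src e == tg_src e') && (tg_tgt e == tg_tgt e').

Definition opposite_orientation T (e e' : tg_edge T) : bool :=
  (tg_src e == tg_tgt e') && (tg_tgt e == tg_src e').

Definition same_endpoints T (e e' : tg_edge T) : bool :=
  same_orientation e e' || opposite_orientation e e'.

Definition edge_multiplicity T (e : tg_edge T) : nat :=
  #|[set e' | same_endpoints e e']|.

Definition twin T (e e' : tg_edge T) : bool :=
  (e != e') && same_endpoints e e'.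

Definition fat_tree T : Prop := is_tree (@tg_adj T).

Definition double_tree T : Prop :=
  fat_tree T /\ forall e : tg_edge T, edge_multiplicity e = 2%N.

Definition colored_double_tree T : Prop :=
  double_tree T /\
  forall e e' : tg_edge T, twin e e' -> tg_label e = tg_label e'.

(* ell_j(T) and k_j(T): the pairs are counted as unordered pairs {e, e'}. *)
Definition twins_opposite T (j : J) : nat :=
  #|[set q : {set tg_edge T} | [exists e, [exists e',
      [&& q == [set e; e'], twin e e', opposite_orientation e e',
          tg_label e == j & tg_label e' == j]]]]|.

Definition twins_same T (j : J) : nat :=
  #|[set q : {set tg_edge T} | [exists e, [exists e',
      [&& q == [set e; e'], twin e e', same_orientation e e',
          tg_label e == j & tg_label e' == j]]]]|.

End TestGraphs.

Local Open Scope classical_set_scope.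

Section ComplexRandomVariables.
Context {R : realType}.
Implicit Types (d : measure_display).

(* C = R[i] is identified with R * R as a measurable space. *)
Definition C_to_R2 (z : R[i]) : R * R := (complex.Re z, complex.Im z).

Definition complex_rv d (Om : measurableType d) (X : Om -> R[i]) : Prop :=
  measurable_fun [set: Om] (C_to_R2 \o X).

Definition C_expectation d (Om : measurableType d) (P : probability Om R)
    (X : Om -> R[i]) : R[i] :=
  fine 'E_P[fun w => complex.Re (X w)] +i* fine 'E_P[fun w => complex.Im (X w)].

Definition same_law d (Om : measurableType d) (P : probability Om R)
    d' (Om' : measurableType d') (P' : probability Om' R)
    (X : Om -> R[i]) (X' : Om' -> R[i]) : Prop :=
  forall B : set (R * R), measurable B ->
    P ((C_to_R2 \o X) @^-1` B) = P' ((C_to_R2 \o X') @^-1` B).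

Definition sigma_rv d (Om : measurableType d) (X : Om -> R[i]) :
    set (set Om) :=
  preimage_set_system [set: Om] (C_to_R2 \o X) measurable.

Definition sigma_mx d (Om : measurableType d) n (A : Om -> 'M[R[i]]_n) :
    set (set Om) :=
  <<s \bigcup_(p in [set: 'I_n * 'I_n]) sigma_rv (fun w => A w p.1 p.2) >>.

Definition mutually_independent d (Om : measurableType d)
    (P : probability Om R) (I : eqType) (D : set I) (F : I -> set (set Om)) :
    Prop :=
  forall (s : seq I) (B : I -> set Om), uniq s ->
    (forall i, i \in s -> D i /\ F i (B i)) ->
    P (\bigcap_(i in [set` s]) B i) = (\prod_(i <- s) P (B i))%E.

End ComplexRandomVariables.

Section WignerMatrices.
Context {R : realType}.
(* The matrices of different sizes N may live on different probability spaces. *)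
Variables (d : nat -> measure_display) (Om : forall N, measurableType (d N)).
Variable P : forall N, probability (Om N) R.

(* [x N w] is the matrix of the unnormalized entries x_{i,j}; the associated
   Wigner matrix is [normalized x]. *)
Record wigner (x : forall N, Om N -> 'M[R[i]]_N) : Prop := Wigner {
  wigner_rv : forall N (i k : 'I_N), complex_rv (fun w => x N w i k);
  wigner_hermitian : forall N (w : Om N) (i k : 'I_N), x N w i k = (x N w k i)^*;
  wigner_indep : forall N, mutually_independent (P N)
    [set p : 'I_N * 'I_N | (p.2 <= p.1)%N]
    (fun p => sigma_rv (fun w => x N w p.1 p.2));
  wigner_diag_law : forall N M (i : 'I_N) (k : 'I_M),
    same_law (P N) (P M) (fun w => x N w i i) (fun w => x M w k k);
  wigner_offdiag_law : forall N M (i j : 'I_N) (k l : 'I_M),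
    (j < i)%N -> (l < k)%N ->
    same_law (P N) (P M) (fun w => x N w i j) (fun w => x M w k l);
  wigner_moments : forall N (i k : 'I_N) (n : nat),
    ('E_(P N)[fun w => (complex.Re `|x N w i k| ^+ n)%R] < +oo)%E;
  wigner_centered : forall N (i k : 'I_N),
    C_expectation (P N) (fun w => x N w i k) = 0 }.

Definition wigner_parameter (x : forall N, Om N -> 'M[R[i]]_N)
    (alpha beta : R[i]) : Prop :=
  forall N (i k : 'I_N), i != k ->
    C_expectation (P N) (fun w => `|x N w i k| ^+ 2) = alpha /\
    C_expectation (P N) (fun w => x N w i k ^+ 2) = beta.

Definition conj_invariant (x : forall N, Om N -> 'M[R[i]]_N) : Prop :=
  forall N (i k : 'I_N),
    same_law (P N) (P N) (fun w => x N w i k) (fun w => (x N w i k)^*).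

Definition normalized (x : forall N, Om N -> 'M[R[i]]_N) :
    forall N, Om N -> 'M[R[i]]_N :=
  fun N w => ((Num.sqrt N%:R)^-1)%:C *: x N w.

(* The functional tau_N^0[T(A_N)]. *)
Definition tau0 (J : Type) (A : J -> forall N, Om N -> 'M[R[i]]_N)
    (T : test_graph J) (N : nat) : R[i] :=
  C_expectation (P N) (fun w => N%:R^-1 *
    \sum_(phi : {ffun tg_vertex T -> 'I_N} | injectiveb phi)
      \prod_(e : tg_edge T)
        A (tg_label e) N w (phi (tg_tgt e)) (phi (tg_src e))).

Definition has_limiting_traffic_distribution (J : Type)
    (A : J -> forall N, Om N -> 'M[R[i]]_N) : Prop :=
  forall T : test_graph J, cvgn (tau0 A T : nat -> R[i]^o).

End WignerMatrices.

(* Main.v *)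
Require Import Defs.
From HB Require Import structures.
From mathcomp Require Import all_boot all_order all_algebra.
From mathcomp Require Import complex.
From mathcomp Require Import all_classical all_reals all_analysis.
From mathcomp Require Import measurable_realfun.
From mathcomp Require Import ring lra zify.
Set Implicit Arguments.
Unset Strict Implicit.
Unset Printing Implicit Defensive.
Import Order.TTheory GRing.Theory Num.Theory.
Import numFieldNormedType.Exports.

(** By linearity, [tau0] is the sum over the injective labellings [phi] of the
    vertices of the expectation of a product of [#|E|] unnormalized entries,
    multiplied by [N ^ (- 1 - #|E| / 2)].

    Fix [phi]. Edges with the same label and the same ends form a block. Since
    [phi] is injective, edges of one block see the same entry up to conjugation,
    and distinct blocks see independent entries; hence the expectation is the
    product over the blocks of the expectations of the block products
    ([edge_product_blocks]). This rests on the joint independence of all entries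
    on or below the diagonals ([entries_indep]) and on the product formula for
    expectations of independent complex variables ([C_expectation_prod]).

    If a block has a single edge, the expectation vanishes because the entries
    are centered. If all blocks have at least two edges, then
    [#|E| >= 2 #|blocks|], the number of blocks is at least the number of edges
    of the underlying simple graph, and this number is at least [#|V| - 1] by
    connectedness. As the expectations are bounded uniformly in [N] and [phi]
    ([edge_product_bound]) and there are at most [N ^ #|V|] labellings, the sum is
    [O(N ^ (#|V| - 1 - #|E| / 2))]. It tends to 0 unless all these inequalities
    are equalities, that is, unless the graph is a colored double tree
    ([blocks_colored_double_tree]).

    For a colored double tree, a block is a pair of twins labelled [j] and
    contributes [alpha j] or [beta j] according to the orientations, whatever
    [phi] is. As [#|E| = 2 (#|V| - 1)], what is left is the number
    [N ^_ #|V|] of injections divided by [N ^ #|V|], which tends to 1. *)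

(** * Counting the edges of a tree *)

Lemma set2_eq (T : finType) (a b c d : T) :
  ([set a; b] == [set c; d]) = ((a == c) && (b == d)) || ((a == d) && (b == c)).
Proof.
apply/eqP/orP => [H|[/andP[/eqP-> /eqP->]//|/andP[/eqP-> /eqP->]]]; last first.
  by rewrite finset.setUC.
have Ha : a \in [set c; d] by rewrite -H !inE eqxx.
have Hb : b \in [set c; d] by rewrite -H !inE eqxx orbT.
have Hc : c \in [set a; b] by rewrite H !inE eqxx.
have Hd : d \in [set a; b] by rewrite H !inE eqxx orbT.
move: Ha Hb Hc Hd; rewrite !inE.
move=> /orP[]/eqP Ha /orP[]/eqP Hb /orP[]/eqP Hc /orP[]/eqP Hd;
  by [left; apply/andP; split; apply/eqP; congruence
     |right; apply/andP; split; apply/eqP; congruence].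
Qed.

Section SpanningTree.
Variables (V : finType) (S : {set {set V}}) (e : rel V).
Hypothesis eE : forall v w, e v w = ([set v; w] \in S).
Hypothesis S2 : forall q, q \in S -> exists v w, q = [set v; w].
Hypothesis e_conn : forall v w, connect e v w.

(** A breadth-first search from [r]: [d] is the distance to [r] and [p v] the
    last vertex before [v] on a shortest path. The edges [{p v, v}] form a
    spanning tree, which is what the counting below compares [S] with. *)
Lemma rank_parent (r : V) : exists (d : V -> nat) (p : V -> V),
  forall v, v != r -> e (p v) v && (d (p v) < d v).
Proof.
pose reach v n := [exists t : n.-tuple V, path e r t && (last r t == v)].
have ex v : exists n, reach v n.
  have /connectP[t pt ->] := e_conn r v.
  by exists (size t); apply/existsP; exists (in_tuple t); rewrite /= pt eqxx.
pose d v := ex_minn (ex v).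
have : forall v, exists u, v != r -> e u v && (d u < d v).
  move=> v; case: (eqVneq v r) => [_|vr]; first by exists r.
  rewrite {2}/d; case: ex_minnP => n /existsP[t /andP[pt /eqP lt]] _.
  case/lastP: (tval t) (size_tuple t) pt lt => [_ _ /= E|q u sq].
    by rewrite E eqxx in vr.
  rewrite rcons_path last_rcons => /andP[pq eu] uv; subst u.
  exists (last r q) => _; rewrite eu /= /d; case: ex_minnP => m _ /(_ (size q)) H.
  rewrite -sq size_rcons ltnS; apply: H; apply/existsP; exists (in_tuple q).
  by rewrite /= pq eqxx.
by move=> /choice[p Hp]; exists d, p.
Qed.

Section Parent.
Variables (r : V) (d : V -> nat) (p : V -> V).
Hypothesis parentP : forall v, v != r -> e (p v) v && (d (p v) < d v).

Let parent_edge v := [set p v; v].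

Lemma parent_edge_inj : {in [set~ r] &, injective parent_edge}.
Proof.
move=> v w; rewrite !inE => /parentP/andP[_ dv] /parentP/andP[_ dw] /eqP.
rewrite set2_eq => /orP[/andP[_ /eqP//]|/andP[/eqP pv /eqP vw]].
by move: dv dw; rewrite pv -vw => a b; lia.
Qed.

Lemma parent_edge_sub : parent_edge @: [set~ r] \subset S.
Proof.
apply/fintype.subsetP => q /imsetP[v]; rewrite !inE => /parentP/andP[ev _] ->.
by rewrite -eE.
Qed.

Lemma parent_edge_card : #|parent_edge @: [set~ r]|.+1 = #|V|.
Proof.
rewrite card_in_imset; last exact: parent_edge_inj.
by rewrite cardsC1 prednK //; apply/card_gt0P; exists r.
Qed.

Lemma parent_edge_surj : #|S| < #|V| -> S = parent_edge @: [set~ r].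
Proof.
move=> SV; apply/esym/eqP; rewrite eqEcard parent_edge_sub /=.
by rewrite -ltnS parent_edge_card.
Qed.

End Parent.

Lemma card_connected (r : V) : #|V| <= #|S|.+1.
Proof.
have [d [p dp]] := rank_parent r.
by rewrite -(parent_edge_card dp) ltnS subset_leq_card // (parent_edge_sub dp).
Qed.

(** [S] is then the set of edges of the spanning tree, so an edge joins a vertex
    to its parent, and the rank decides which end is the parent. *)
Lemma edge_parent (r : V) d p :
    (forall v, v != r -> e (p v) v && (d (p v) < d v)) -> #|S| < #|V| ->
  forall v w, e v w -> d w <= d v -> w = p v /\ d w < d v.
Proof.
move=> dp SV v w; rewrite eE (parent_edge_surj dp SV) => /imsetP[u].
rewrite !inE => /dp/andP[_ du] /eqP; rewrite set2_eq.
move=> /orP[/andP[/eqP-> /eqP->]|/andP[/eqP-> /eqP->//]]; lia.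
Qed.

(** On a cycle, both neighbours of a vertex of maximal rank would be its parent,
    so they would coincide: a cycle cannot have three distinct vertices. *)
Lemma tree_of_card (r : V) : #|S| < #|V| -> is_tree e.
Proof.
move=> SV; have [d [p dp]] := rank_parent r.
have ep := edge_parent dp SV.
have es : symmetric e by move=> v w; rewrite !eE finset.setUC.
split=> // [v|c cc uc]; first by apply/negP => /ep /(_ (leqnn _)) []; rewrite ltnn.
rewrite leqNgt; apply/negP => sc.
have [x xc xM] : exists2 x, x \in c & forall y, y \in c -> d y <= d x.
  case: c cc uc sc => [//|a c] _ _ _.
  case: (@arg_maxnP _ a [in a :: c] d (mem_head _ _)) => x xc xM.
  by exists x.
have [i t Ht] := rot_to xc.
have ct : cycle e (x :: t) by rewrite -Ht rot_cycle.
have ut : uniq (x :: t) by rewrite -Ht rot_uniq.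
have st : 2 < size (x :: t) by rewrite -Ht size_rot.
have tM y : y \in t -> d y <= d x.
  by move=> yt; apply: xM; rewrite -(mem_rot i) Ht inE yt orbT.
case: t Ht ct ut st tM => [//|y t] _ /=.
case/lastP: t => [//|t z]; rewrite rcons_path last_rcons.
move=> /andP[exy /andP[_ ezx]] /andP[_ /andP[yt _]] _ tM.
have [yp _] := ep _ _ exy (tM _ (mem_head _ _)).
rewrite es in ezx; have [|zp _] := ep _ _ ezx.
  by apply: tM; rewrite inE mem_rcons mem_head orbT.
by move: yt; rewrite yp zp mem_rcons mem_head.
Qed.

(** An edge [{u, v}] outside the spanning tree would close a cycle: [u] and [v]
    remain connected through the tree once the edge is deleted, and a simple
    path between them avoiding the edge has at least three vertices. *)
Lemma card_of_tree (r : V) : is_tree e -> #|S| < #|V|.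
Proof.
move=> [_ ei ec]; have [d [p dp]] := rank_parent r.
have es : symmetric e by move=> v w; rewrite !eE finset.setUC.
rewrite -(parent_edge_card dp) ltnS subset_leq_card //.
apply/fintype.subsetP => q qS; have [u [v uv]] := S2 qS; subst q.
apply: contraT => nuv.
pose e' := [rel a b | e a b && ([set a; b] != [set u; v])].
have e's : symmetric e' by move=> a b /=; rewrite es [[set b; a]]finset.setUC.
have e'r w : connect e' w r.
  have [n] := ubnP (d w); elim: n w => // n IH w dw.
  case: (eqVneq w r) => [->|wr]; first exact: connect0.
  have /andP[epw dpw] := dp _ wr.
  apply: connect_trans (IH (p w) _); last by lia.
  apply: connect1; rewrite /= es epw /= finset.setUC.
  apply: contraNneq nuv => <-; apply/imsetP; exists w => //.
  by rewrite !inE.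
have : connect e' u v.
  apply: connect_trans (e'r u) _; rewrite (sym_connect_sym e's); exact: e'r.
move=> /connectP[t0 /shortenP[t pt ut _] lt].
have et : cycle e (u :: t).
  rewrite /= rcons_path -lt es eE qS andbT.
  by apply: sub_path pt => a b /= /andP[].
have := ec _ et ut; case: t pt {ut et} lt => [_ /= E|a [|//]].
  by move: qS; rewrite -eE E ei.
by move=> /= /andP[/andP[_]] + _ E; rewrite E eqxx.
Qed.

End SpanningTree.

(** * Blocks of parallel edges with the same label *)

Section Blocks.
Variables (J : eqType) (T : test_graph J).
Let V := tg_vertex T.
Let E := tg_edge T.
Implicit Types e : E.

Definition ends e : {set V} := [set tg_src e; tg_tgt e].

(** For independent Wigner matrices and an injective labelling of the vertices,
    two edges see the same matrix entry, up to conjugation, exactly when they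
    lie in the same block. *)
Definition block e : {set E} :=
  [set e' | (tg_label e' == tg_label e) && (ends e' == ends e)].

Definition blocks : {set {set E}} := [set block e | e : E].

Definition edge_sets : {set {set V}} := [set ends e | e : E].

Lemma mem_block e : e \in block e.
Proof. by rewrite inE !eqxx. Qed.

Lemma block_eq e e' : (block e == block e') = (e \in block e').
Proof.
apply/eqP/idP => [<-|]; first exact: mem_block.
by rewrite inE => /andP[/eqP le /eqP ee]; apply/finset.setP => x; rewrite !inE le ee.
Qed.

Lemma mem_blocks e : block e \in blocks.
Proof. exact: imset_f. Qed.

Lemma same_endpointsE e e' : same_endpoints e e' = (ends e == ends e').
Proof. by rewrite /ends set2_eq. Qed.

Lemma adj_edge_sets (v w : V) : tg_adj v w = ([set v; w] \in edge_sets).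
Proof.
apply/existsP/imsetP => [[e]|[e _ /eqP]].
  by rewrite -set2_eq => /eqP ew; exists e.
by exists e; rewrite -set2_eq eq_sym.
Qed.

Lemma edge_setsP q : q \in edge_sets -> exists v w, q = [set v; w].
Proof. by move=> /imsetP[e _ ->]; exists (tg_src e), (tg_tgt e). Qed.

Lemma adj_connected (v w : V) : connect (@tg_adj _ T) v w.
Proof. exact: tg_connected. Qed.

Lemma card_edges_blocks : #|E| = \sum_(q in blocks) #|q|.
Proof.
rewrite -sum1_card (partition_big_imset block) /=; apply: eq_bigr => q.
move=> /imsetP[e _ ->]; rewrite sum1dep_card; apply: eq_card => e'.
by rewrite inE block_eq.
Qed.

Lemma card_vertex_edge_sets : #|V| <= #|edge_sets|.+1.
Proof.
have /card_gt0P[r _] := tg_nonempty T.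
exact: (card_connected adj_edge_sets adj_connected r).
Qed.

(* On a block this is the common pair of ends; taking a union avoids choosing an
   edge of the block. *)
Let common_ends (q : {set E}) : {set V} := \bigcup_(e in q) ends e.

Lemma common_ends_block e : common_ends (block e) = ends e.
Proof.
apply/finset.setP => v; apply/bigcupP/idP => [[e']|ve].
  by rewrite inE => /andP[_ /eqP->].
by exists e => //; exact: mem_block.
Qed.

Lemma edge_sets_blocks : edge_sets = common_ends @: blocks.
Proof.
apply/finset.setP => s; apply/imsetP/imsetP => [[e _ ->]|[_ /imsetP[e _ ->] ->]].
  by exists (block e); rewrite ?common_ends_block ?mem_blocks.
by exists e; rewrite ?common_ends_block.
Qed.

(** The chain [2 (#|V| - 1) <= 2 #|edge_sets| <= 2 #|blocks| <= #|E|] collapses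
    under the bound on [#|E|]. The first equality makes the graph a tree, the
    second one says that twin edges have equal labels, and the third one that
    every block has exactly two edges. *)
Lemma blocks_colored_double_tree :
  (forall q, q \in blocks -> 1 < #|q|) -> #|E| + 2 <= 2 * #|V| ->
  colored_double_tree T.
Proof.
move=> q2 EV; have V1 := card_vertex_edge_sets.
have SQ : #|edge_sets| <= #|blocks| by rewrite edge_sets_blocks leq_imset_card.
have EQ : 2 * #|blocks| <= #|E|.
  rewrite card_edges_blocks mulnC -sum_nat_const; apply: leq_sum => q; exact: q2.
have SQ' : #|edge_sets| = #|blocks| by lia.
have inj : {in blocks &, injective common_ends}.
  by apply/imset_injP; rewrite -edge_sets_blocks SQ'.
have eb e e' : ends e = ends e' -> block e = block e'.
  move=> ee; apply: inj; rewrite ?mem_blocks ?common_ends_block //.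
have card2 q : q \in blocks -> #|q| = 2.
  move=> qQ; apply/eqP; rewrite eqn_leq q2 // andbT leqNgt; apply/negP => q3.
  have : #|blocks| * 2 < \sum_(q in blocks) #|q|.
    rewrite -sum_nat_const (bigD1 q) //= [ltnRHS](bigD1 q) //= -addSn.
    by apply: leq_add => //; apply: leq_sum => p /andP[/q2].
  by rewrite -card_edges_blocks; lia.
have /card_gt0P[r _] := tg_nonempty T.
split; first split.
- apply: (tree_of_card adj_edge_sets adj_connected r).
  by rewrite -/V; lia.
- move=> e; rewrite /edge_multiplicity -(card2 _ (mem_blocks e)).
  apply: eq_card => e'; rewrite inE same_endpointsE.
  apply/eqP/idP => [/eb->|]; first exact: mem_block.
  by rewrite inE => /andP[_ /eqP->].
- move=> e e' /andP[_]; rewrite same_endpointsE => /eqP/eb ee.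
  by have := mem_block e; rewrite ee inE => /andP[/eqP].
Qed.

Lemma double_tree_card : double_tree T -> #|E| + 2 = 2 * #|V|.
Proof.
move=> [tree m2].
have /card_gt0P[r _] := tg_nonempty T.
have := card_of_tree adj_edge_sets edge_setsP adj_connected r tree.
have := card_vertex_edge_sets.
suff -> : #|E| = #|edge_sets| * 2 by rewrite /V; lia.
rewrite -sum_nat_const -sum1_card (partition_big_imset ends) /=.
apply: eq_bigr => q /imsetP[e _ ->]; rewrite -(m2 e) sum1dep_card.
by apply: eq_card => e'; rewrite !inE same_endpointsE eq_sym.
Qed.

Lemma colored_double_tree_block e : colored_double_tree T ->
  exists2 e', twin e e' & block e = [set e; e'] /\ tg_label e' = tg_label e.
Proof.
move=> [[_ m2] col].
have be : block e = [set e' | same_endpoints e e'].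
  apply/finset.setP => e'; rewrite !inE same_endpointsE eq_sym andbC.
  case: eqVneq => //= ee; case: (eqVneq e e') => [->|ne]; first exact: eqxx.
  by rewrite (col e' e) ?eqxx // /twin eq_sym ne same_endpointsE ee eqxx.
have /eqP/cards2P[a [b [ab bab]]] := m2 e.
have : e \in [set a; b] by rewrite -bab -be mem_block.
have bl e' : e' \in block e -> e != e' ->
    twin e e' /\ tg_label e' = tg_label e.
  move=> e'b ne; have t : twin e e'.
    by rewrite /twin ne; move: e'b; rewrite be inE.
  by split => //; rewrite (col _ _ t).
rewrite !inE => /orP[]/eqP ?; subst.
- have [||t l] := bl b; rewrite ?be ?bab ?inE ?eqxx ?orbT //.
  by exists b.
- have [||t l] := bl a; rewrite 1?[b == a]eq_sym ?be ?bab ?inE ?eqxx ?orbT //.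
  by exists a => //; rewrite [in RHS]finset.setUC.
Qed.

End Blocks.

(** * Pairs of twin edges *)

Section TwinPairs.
Variables (J : eqType) (T : test_graph J).
Let E := tg_edge T.
Implicit Types e : E.

(** With [o] the relation of having opposite, resp. same, orientation, the
    cardinals of these sets are [twins_opposite] and [twins_same]. *)
Definition twin_pairs (o : rel E) (j : J) : {set {set E}} :=
  [set q : {set E} | [exists e, [exists e',
     [&& q == [set e; e'], twin e e', o e e', tg_label e == j & tg_label e' == j]]]].

Definition labels : seq J := undup [seq tg_label e | e <- enum E].

Lemma twin_pairs_sub (o : rel E) j : colored_double_tree T ->
  twin_pairs o j \subset blocks T.
Proof.
move=> cT; apply/fintype.subsetP => q; rewrite inE.
move=> /existsP[e /existsP[e' /and5P[/eqP-> tee _ /eqP le /eqP le']]].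
have [e1 te1 [be1 _]] := colored_double_tree_block e cT.
suff <- : block e = [set e; e'] by exact: mem_blocks.
have : e' \in block e.
  by move: tee => /andP[_]; rewrite same_endpointsE inE le le' eqxx eq_sym.
rewrite be1 !inE => /orP[/eqP E1|/eqP->//].
by move: tee; rewrite /twin E1 eqxx.
Qed.

Lemma mem_twin_pairs (o : rel E) e e' j : symmetric o ->
  twin e e' -> tg_label e' = tg_label e ->
  ([set e; e'] \in twin_pairs o j) = (tg_label e == j) && o e e'.
Proof.
move=> os tee ll; rewrite inE; apply/existsP/andP => [[a /existsP[b]]|[lj oee]].
  move=> /and5P[]; rewrite set2_eq.
  move=> /orP[]/andP[/eqP<- /eqP<-] _ ? la lb; last by rewrite os.
  by [].
by exists e; apply/existsP; exists e'; rewrite eqxx tee oee ll lj.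
Qed.

Lemma same_orientation_sym : symmetric (@same_orientation J T).
Proof. by move=> e e'; congr (_ && _); exact: eq_sym. Qed.

Lemma opposite_orientation_sym : symmetric (@opposite_orientation J T).
Proof.
by move=> e e'; rewrite /opposite_orientation andbC; congr (_ && _); exact: eq_sym.
Qed.

Lemma tree_no_loop e : fat_tree T -> tg_src e != tg_tgt e.
Proof.
move=> [_ irr _]; apply/eqP => le.
have : ends e \in edge_sets T by exact: imset_f.
by rewrite /ends -le -adj_edge_sets irr.
Qed.

End TwinPairs.

Local Open Scope classical_set_scope.
Local Open Scope ring_scope.
Local Open Scope complex_scope.

(** * Real expectations and independence *)

Section RealExpectation.
Context {R : realType} (dO : measure_display) (Om : measurableType dO).
Variable P : probability Om R.
Implicit Types f g W : Om -> R.

Local Notation L1 f := (P.-integrable [set: Om] (EFin \o f)).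

Lemma L1_measurable f : L1 f -> measurable_fun setT f.
Proof. by move=> /measurable_int/measurable_EFinP. Qed.

Lemma L1_le f g : measurable_fun setT f -> (forall w, `|f w| <= g w) ->
  L1 g -> L1 f.
Proof.
move=> mf fg; apply: le_integrable => //; first exact/measurable_EFinP.
by move=> w _ /=; rewrite lee_fin (le_trans (fg w))// ler_norm.
Qed.

Lemma L1_add f g : L1 f -> L1 g -> L1 (fun w => f w + g w).
Proof.
move=> If Ig; apply: eq_integrable (integrableD measurableT If Ig) => //.
Qed.

Lemma L1_scale (c : R) f : L1 f -> L1 (fun w => c * f w).
Proof.
move=> If; apply: eq_integrable (integrableZl measurableT c If) => //.
Qed.

Lemma L1_cst (c : R) : L1 (fun=> c).
Proof.
apply/integrableP; split; first exact/measurable_EFinP/measurable_cst.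
by rewrite integral_cst//= probability_setT mule1 ltey.
Qed.

Lemma Rintegral_cst1 (c : R) : \int[P]_w c = c.
Proof. by rewrite Rintegral_cst//= probability_setT mulr1. Qed.

Lemma Rintegral_sum (I : Type) (s : seq I) (Q : pred I) (f : I -> Om -> R) :
  (forall i, Q i -> L1 (f i)) ->
  L1 (fun w => \sum_(i <- s | Q i) f i w) /\
  \int[P]_w (\sum_(i <- s | Q i) f i w) = \sum_(i <- s | Q i) \int[P]_w f i w.
Proof.
move=> If; elim: s => [|i s [IH1 IH2]].
  rewrite big_nil; split; first under eq_fun do rewrite big_nil; first exact: L1_cst.
  by under eq_Rintegral do rewrite big_nil; rewrite Rintegral_cst ?mul0r.
have E : (fun w => \sum_(j <- i :: s | Q j) f j w) =
    fun w => if Q i then f i w + \sum_(j <- s | Q j) f j w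
             else \sum_(j <- s | Q j) f j w.
  by apply/funext => w; rewrite big_cons.
rewrite E big_cons; case: ifP => // Qi; split; first exact: L1_add (If _ Qi) IH1.
by rewrite RintegralD ?IH2 //; exact: If.
Qed.

Import HBNNSimple.

(** If [W] is uncorrelated with every event [Y \in B], then it is uncorrelated
    with every integrable function of [Y]. The passage is the standard one:
    simple functions by linearity, nonnegative functions by dominated
    convergence along an increasing sequence of simple functions, and
    then positive and negative parts. The constant [c] stands for the
    expectation of [W]. *)
Section Factor.
Context (dU : measure_display) (U : measurableType dU).
Variables (W : Om -> R) (Y : Om -> U) (c : R).
Hypotheses (IW : L1 W) (mY : measurable_fun setT Y).
Hypothesis W_indep : forall B, measurable B ->
  \int[P]_w (W w * \1_B (Y w)) = c * \int[P]_w \1_B (Y w).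

Let indY B : measurable B -> measurable_fun setT (fun w => \1_B (Y w) : R).
Proof. by move=> mB; apply: measurableT_comp mY; exact: measurable_indic. Qed.

Let L1_indY B : measurable B -> L1 (fun w => \1_B (Y w)).
Proof.
move=> mB; apply: (L1_le (indY mB)) (L1_cst 1) => w.
by rewrite indicE; case: (_ \in _); rewrite ?normr1 ?normr0.
Qed.

Let L1_WindY B : measurable B -> L1 (fun w => W w * \1_B (Y w)).
Proof.
move=> mB; have := integrable_abse IW; apply: L1_le.
  by apply: measurable_funM; [exact: L1_measurable|exact: indY].
move=> w; rewrite normrM indicE /=.
by case: (_ \in _); rewrite ?normr1 ?normr0 ?mulr1 ?mulr0.
Qed.

Let factor_simple (h : {nnsfun U >-> R}) :
  [/\ L1 (fun w => h (Y w)), L1 (fun w => W w * h (Y w))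
    & \int[P]_w (W w * h (Y w)) = c * \int[P]_w h (Y w)].
Proof.
have [s Hs] : exists s : seq R, forall u,
    h u = \sum_(r <- s) r * \1_(h @^-1` [set r]) u.
  exists (finmap.enum_fset (fset_set (range h))) => u; rewrite fimfunE fsbig_finite //=.
have mr r : measurable (h @^-1` [set r]) by exact: measurable_sfunP.
have I1 r : L1 (fun w => r * \1_(h @^-1` [set r]) (Y w)) by exact/L1_scale/L1_indY.
have I2 r : L1 (fun w => r * (W w * \1_(h @^-1` [set r]) (Y w))).
  exact/L1_scale/L1_WindY.
have [J1 E1] := Rintegral_sum s (fun r (_ : true) => I1 r).
have [J2 E2] := Rintegral_sum s (fun r (_ : true) => I2 r).
have hE : (fun w => h (Y w)) = fun w => \sum_(r <- s) r * \1_(h @^-1` [set r]) (Y w).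
  by apply/funext => w; rewrite Hs.
have WhE : (fun w => W w * h (Y w)) =
    fun w => \sum_(r <- s) r * (W w * \1_(h @^-1` [set r]) (Y w)).
  by apply/funext => w; rewrite Hs mulr_sumr; apply: eq_bigr => r _; ring.
split; rewrite ?hE ?WhE //.
rewrite E1 E2 mulr_sumr; apply: eq_bigr => r _.
rewrite !RintegralZl ?W_indep //; [|exact: L1_indY|exact: L1_WindY].
by ring.
Qed.

Let cvg_Rintegral (h : nat -> Om -> R) (f g : Om -> R) :
  (forall n, measurable_fun setT (h n)) -> measurable_fun setT f -> L1 g ->
  (forall w, h ^~ w @ \oo --> f w) -> (forall n w, `|h n w| <= g w) ->
  (fun n => \int[P]_w h n w) @ \oo --> \int[P]_w f w.
Proof.
move=> mh mf Ig hf hg.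
have hfE w : (fun n => (h n w)%:E) @ \oo --> (f w)%:E.
  by apply: cvg_EFin; [exact: nearW|exact: hf].
have [If _] := @dominated_convergence _ Om R P setT measurableT
  (fun n w => (h n w)%:E) (fun w => (f w)%:E) (fun w => (g w)%:E)
  (fun n => (measurable_EFinP _ _).2 (mh n)) ((measurable_EFinP _ _).2 mf)
  (aeW _ (fun w _ => hfE w)) Ig (aeW _ (fun w n _ => hg n w)).
move=> H; apply: fine_cvg; rewrite fineK; first exact: H.
exact: integrable_fin_num.
Qed.

Let factor_ge0 (f : U -> R) : measurable_fun setT f -> (forall u, 0 <= f u) ->
  L1 (fun w => f (Y w)) -> L1 (fun w => W w * f (Y w)) ->
  \int[P]_w (W w * f (Y w)) = c * \int[P]_w f (Y w).
Proof.
move=> mf f0 If IWf.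
pose h := nnsfun_approx measurableT ((measurable_EFinP _ _).2 mf).
have hf u : h ^~ u @ \oo --> f u.
  have H : EFin \o h ^~ u @ \oo --> (f u)%:E.
    by apply: cvg_nnsfun_approx => // v _; rewrite lee_fin.
  exact: (fine_cvg H).
have hle n u : `|h n u| <= f u.
  rewrite ger0_norm//.
  have nd : nondecreasing_seq (h ^~ u) by move=> a b ab; exact/lefP/nd_nnsfun_approx.
  have cv : cvgn (h ^~ u) by apply/cvg_ex; exists (f u).
  rewrite -(cvg_lim _ (hf u))//; exact: nondecreasing_cvgn_le.
have mW := L1_measurable IW.
have mhY n : measurable_fun setT (fun w => h n (Y w)).
  by apply: measurableT_comp mY.
have mfY : measurable_fun setT (fun w => f (Y w)) by apply: measurableT_comp mY.
have L : (fun n => \int[P]_w (W w * h n (Y w))) @ \oo --> \int[P]_w (W w * f (Y w)).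
  apply: (cvg_Rintegral _ _ (integrable_abse IWf)) => /=.
  - by move=> n; apply: measurable_funM.
  - exact: measurable_funM.
  - by move=> w; apply: cvgMr; exact: hf.
  - by move=> n w; rewrite !normrM ler_wpM2l// [leRHS]ger0_norm.
have L' : (fun n => \int[P]_w (W w * h n (Y w))) @ \oo --> c * \int[P]_w (f (Y w)).
  have -> : (fun n => \int[P]_w (W w * h n (Y w))) = fun n => c * \int[P]_w h n (Y w).
    by apply/funext => n; have [_ _ ->] := factor_simple (h n).
  by apply: cvgMr; apply: (cvg_Rintegral _ _ If).
by rewrite -(cvg_lim _ L)// (cvg_lim _ L').
Qed.

Lemma Rintegral_factor (f : U -> R) : measurable_fun setT f ->
  L1 (fun w => f (Y w)) -> L1 (fun w => W w * f (Y w)) ->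
  \int[P]_w (W w * f (Y w)) = c * \int[P]_w f (Y w).
Proof.
move=> mf If IWf.
pose p u := Num.max (f u) 0; pose n u := Num.max (- f u) 0.
have fE u : f u = p u - n u by rewrite /p /n /Num.max; do 2 case: ifP; lra.
have mp : measurable_fun setT p by exact: measurable_maxr.
have mn : measurable_fun setT n by apply: measurable_maxr => //; exact: measurable_funN.
have p0 u : 0 <= p u by rewrite /p le_max lexx orbT.
have n0 u : 0 <= n u by rewrite /n le_max lexx orbT.
have pf u : `|p u| <= `|f u|.
  by rewrite ger0_norm// /p ge_max normr_ge0 ler_norm.
have nf u : `|n u| <= `|f u|.
  by rewrite ger0_norm// /n ge_max normr_ge0 -normrN ler_norm.
have mW := L1_measurable IW.
have L1Y (g : U -> R) : measurable_fun setT g -> (forall u, `|g u| <= `|f u|) ->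
    L1 (fun w => g (Y w)) /\ L1 (fun w => W w * g (Y w)).
  move=> mg gf; have mgY : measurable_fun setT (fun w => g (Y w)).
    by apply: measurableT_comp mY.
  split.
    by apply: L1_le (integrable_abse If).
  apply: L1_le (integrable_abse IWf); first exact: measurable_funM.
  by move=> w; rewrite /= !normrM ler_wpM2l.
have [Ip IWp] := L1Y p mp pf; have [In IWn] := L1Y n mn nf.
have -> : \int[P]_w (W w * f (Y w)) = \int[P]_w (W w * p (Y w) - W w * n (Y w)).
  by apply: eq_Rintegral => w _; rewrite fE; ring.
have -> : \int[P]_w f (Y w) = \int[P]_w (p (Y w) - n (Y w)).
  by apply: eq_Rintegral => w _; rewrite fE.
by rewrite !RintegralB// !factor_ge0//; ring.
Qed.

End Factor.
End RealExpectation.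

(** * Complex variables with all moments *)

Section ComplexExpectation.
Context {R : realType} (dO : measure_display) (Om : measurableType dO).
Variable P : probability Om R.
Implicit Types X Y W : Om -> R[i].

Local Notation L1 f := (P.-integrable [set: Om] (EFin \o f)).
Local Notation CE := (C_expectation P).

(** The squared modulus as a real number. It is multiplicative and polynomial in
    the coordinates, so that moments can be handled without square roots. *)
Definition nsq (z : R[i]) : R := complex.Re z ^+ 2 + complex.Im z ^+ 2.

Lemma nsq_ge0 z : 0 <= nsq z.
Proof. by rewrite addr_ge0// sqr_ge0. Qed.

Lemma nsqM z z' : nsq (z * z') = nsq z * nsq z'.
Proof. by case: z => a b; case: z' => a' b'; rewrite /nsq /=; ring. Qed.

Lemma nsq_conj z : nsq (z^*) = nsq z.
Proof. by case: z => a b; rewrite /nsq /= sqrrN. Qed.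

Lemma complex_rvP X : complex_rv X <->
  measurable_fun setT (@complex.Re R \o X) /\ measurable_fun setT (@complex.Im R \o X).
Proof. exact: measurable_fun_pairP. Qed.

Definition all_moments X :=
  complex_rv X /\ forall m, L1 (fun w => nsq (X w) ^+ m).

Lemma complex_rv_mul X Y : complex_rv X -> complex_rv Y ->
  complex_rv (fun w => X w * Y w).
Proof.
move=> /complex_rvP[mX mX'] /complex_rvP[mY mY'].
apply/complex_rvP; split.
  rewrite (_ : _ \o _ = fun w => complex.Re (X w) * complex.Re (Y w) -
     complex.Im (X w) * complex.Im (Y w)).
    by apply: measurable_funB; exact: measurable_funM.
  by apply/funext => w /=; case: (X w); case: (Y w).
rewrite (_ : _ \o _ = fun w => complex.Re (X w) * complex.Im (Y w) +
    complex.Im (X w) * complex.Re (Y w)).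
  by apply: measurable_funD; exact: measurable_funM.
by apply/funext => w /=; case: (X w) => a b; case: (Y w) => a' b' /=; ring.
Qed.

Lemma complex_rv_conj X : complex_rv X -> complex_rv (fun w => (X w)^*).
Proof.
move=> /complex_rvP[mX mX']; apply/complex_rvP; split.
  by apply: eq_measurable_fun mX => w _ /=; case: (X w).
by apply: eq_measurable_fun (measurable_funN mX') => w _ /=; case: (X w).
Qed.

Lemma complex_rv_cst (c : R[i]) : complex_rv (fun _ : Om => c).
Proof. by apply/complex_rvP; split; exact: measurable_cst. Qed.

Lemma complex_rv_prod (I : Type) (s : seq I) (Q : pred I) (X : I -> Om -> R[i]) :
  (forall i, complex_rv (X i)) -> complex_rv (fun w => \prod_(i <- s | Q i) X i w).
Proof.
move=> mX; elim: s => [|i s IH].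
  by under eq_fun do rewrite big_nil; exact: complex_rv_cst.
have E : (fun w => \prod_(j <- i :: s | Q j) X j w) =
    fun w => if Q i then X i w * \prod_(j <- s | Q j) X j w
             else \prod_(j <- s | Q j) X j w.
  by apply/funext => w; rewrite big_cons.
by rewrite E; case: (Q i) => //; exact: complex_rv_mul.
Qed.

(** By [2 a b <= a ^ 2 + b ^ 2], applied to powers of the squared moduli; the
    moments of a product cost moments of twice the order. *)
Lemma all_moments_mul X Y : all_moments X -> all_moments Y ->
  all_moments (fun w => X w * Y w).
Proof.
move=> [mX IX] [mY IY]; split; first exact: complex_rv_mul.
move=> m; apply: L1_le (L1_add (IX (m * 2)%N) (IY (m * 2)%N)).
  have -> : (fun w => nsq (X w * Y w) ^+ m) =
      fun w => nsq (X w) ^+ m * nsq (Y w) ^+ m.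
    by apply/funext => w; rewrite nsqM exprMn.
  by apply: measurable_funM; exact: L1_measurable.
move=> w; rewrite nsqM exprMn !exprM normrM.
have a0 : 0 <= nsq (X w) ^+ m by rewrite exprn_ge0// nsq_ge0.
have b0 : 0 <= nsq (Y w) ^+ m by rewrite exprn_ge0// nsq_ge0.
by rewrite !ger0_norm//; nra.
Qed.

Lemma all_moments_bounded X (M : R) : complex_rv X -> (forall w, nsq (X w) <= M) ->
  all_moments X.
Proof.
move=> mX XM; split=> // m; apply: L1_le (L1_cst P (M ^+ m)).
  have /complex_rvP[m1 m2] := mX.
  by apply: measurable_funX; apply: measurable_funD; apply: measurable_funX.
move=> w; rewrite ger0_norm ?exprn_ge0 ?nsq_ge0//.
by rewrite lerXn2r ?nnegrE ?nsq_ge0// (le_trans _ (XM w))// nsq_ge0.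
Qed.

Lemma all_moments_cst c : all_moments (fun=> c).
Proof.
exact: (@all_moments_bounded _ (nsq c) (complex_rv_cst c)).
Qed.

Lemma all_moments_prod (I : eqType) (s : seq I) (Q : pred I) (X : I -> Om -> R[i]) :
  (forall i, i \in s -> Q i -> all_moments (X i)) ->
  all_moments (fun w => \prod_(i <- s | Q i) X i w).
Proof.
elim: s => [_|i s IH sX].
  by under eq_fun do rewrite big_nil; exact: all_moments_cst.
have E : (fun w => \prod_(j <- i :: s | Q j) X j w) =
    fun w => if Q i then X i w * \prod_(j <- s | Q j) X j w
             else \prod_(j <- s | Q j) X j w.
  by apply/funext => w; rewrite big_cons.
have IHs : all_moments (fun w => \prod_(j <- s | Q j) X j w).
  by apply: IH => j js; apply: sX; rewrite inE js orbT.
rewrite E; case Qi: (Q i) => //; apply: all_moments_mul => //.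
by apply: sX => //; exact: mem_head.
Qed.

Definition C_integrable X :=
  L1 (fun w => complex.Re (X w)) /\ L1 (fun w => complex.Im (X w)).

Lemma all_moments_L1M X Y (f g : R[i] -> R) :
  all_moments X -> all_moments Y ->
  measurable_fun setT (f \o X) -> measurable_fun setT (g \o Y) ->
  (forall z, f z ^+ 2 <= nsq z) -> (forall z, g z ^+ 2 <= nsq z) ->
  L1 (fun w => f (X w) * g (Y w)).
Proof.
move=> [_ IX] [_ IY] mf mg fn gn.
apply: L1_le (L1_add (IX 1) (IY 1)); first exact: measurable_funM.
move=> w; rewrite !expr1; have := fn (X w); have := gn (Y w).
by rewrite ler_norml; move: (f _) (g _) => a b; nra.
Qed.

Lemma Re_nsq z : complex.Re z ^+ 2 <= nsq z.
Proof. by rewrite /nsq lerDl sqr_ge0. Qed.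

Lemma Im_nsq z : complex.Im z ^+ 2 <= nsq z.
Proof. by rewrite /nsq lerDr sqr_ge0. Qed.

Lemma all_moments_integrable X : all_moments X -> C_integrable X.
Proof.
move=> [mX IX]; have /complex_rvP[m1 m2] := mX.
split; apply: L1_le (L1_add (L1_cst P 1) (IX 1)) => // w; rewrite expr1.
- by have := Re_nsq (X w); rewrite ler_norml; move: (complex.Re _) => a; nra.
- by have := Im_nsq (X w); rewrite ler_norml; move: (complex.Im _) => a; nra.
Qed.

Lemma C_expectationE X : CE X =
  (\int[P]_w complex.Re (X w)) +i* (\int[P]_w complex.Im (X w)).
Proof. by rewrite /C_expectation unlock. Qed.

Lemma C_expectation_real (f : Om -> R) : CE (fun w => (f w)%:C) = (\int[P]_w f w)%:C.
Proof. by rewrite C_expectationE /= Rintegral_cst// mul0r. Qed.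

Lemma C_expectation_scale (c : R[i]) X : C_integrable X ->
  C_integrable (fun w => c * X w) /\ CE (fun w => c * X w) = c * CE X.
Proof.
move=> [I1 I2]; case: c => a b.
have ER : (fun w => complex.Re ((a +i* b) * X w)) =
    fun w => a * complex.Re (X w) + - b * complex.Im (X w).
  by apply/funext => w; case: (X w) => x y /=; ring.
have EI : (fun w => complex.Im ((a +i* b) * X w)) =
    fun w => a * complex.Im (X w) + b * complex.Re (X w).
  by apply/funext => w; case: (X w) => x y /=; ring.
split; first by split; rewrite ?ER ?EI; apply: L1_add; exact: L1_scale.
rewrite !C_expectationE EI ER !RintegralD ?RintegralZl//; try exact: L1_scale.
by apply/eqP; rewrite eq_complex /=; apply/andP; split; apply/eqP; ring.
Qed.

Lemma C_expectation_sum (I : Type) (s : seq I) (Q : pred I) (X : I -> Om -> R[i]) :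
  (forall i, Q i -> C_integrable (X i)) ->
  C_integrable (fun w => \sum_(i <- s | Q i) X i w) /\
  CE (fun w => \sum_(i <- s | Q i) X i w) = \sum_(i <- s | Q i) CE (X i).
Proof.
move=> IX.
have ReE (F : I -> R[i]) : complex.Re (\sum_(i <- s | Q i) F i) =
    \sum_(i <- s | Q i) complex.Re (F i).
  by apply: (big_morph (@complex.Re R)) => // -[? ?] [? ?].
have ImE (F : I -> R[i]) : complex.Im (\sum_(i <- s | Q i) F i) =
    \sum_(i <- s | Q i) complex.Im (F i).
  by apply: (big_morph (@complex.Im R)) => // -[? ?] [? ?].
have [IR ER] := Rintegral_sum s (fun i Qi => (IX i Qi).1).
have [II EI] := Rintegral_sum s (fun i Qi => (IX i Qi).2).
split; first by split; [under eq_fun do rewrite ReE|under eq_fun do rewrite ImE].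
rewrite C_expectationE; under eq_fun do rewrite ReE.
under [X in _ +i* Rintegral _ _ X]eq_fun do rewrite ImE.
rewrite ER EI; apply/eqP; rewrite eq_complex /= ReE ImE; apply/andP; split; apply/eqP;
  by apply: eq_bigr => i _; rewrite C_expectationE.
Qed.

(** The complex form of [Rintegral_factor], applied to the four products of real
    and imaginary parts. *)
Lemma C_expectation_factor W (Y : Om -> R * R) (c : R[i]) (f : R * R -> R[i]) :
  all_moments W -> measurable_fun setT Y ->
  (forall B, measurable B ->
    CE (fun w => W w * (\1_B (Y w) : R)%:C) = c * (\int[P]_w \1_B (Y w))%:C) ->
  measurable_fun setT (C_to_R2 \o f) -> all_moments (fun w => f (Y w)) ->
  CE (fun w => W w * f (Y w)) = c * CE (fun w => f (Y w)).
Proof.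
move=> aW mY HW mf af.
have [IW1 IW2] := all_moments_integrable aW.
have [If1 If2] := all_moments_integrable af.
have /complex_rvP[mW1 mW2] := aW.1.
have /complex_rvP[mfY1 mfY2] := af.1.
have /measurable_fun_pairP[mf1 mf2] := mf.
have HR B : measurable B -> \int[P]_w (complex.Re (W w) * \1_B (Y w)) =
    complex.Re c * \int[P]_w \1_B (Y w).
  move=> /HW; rewrite C_expectationE => /(congr1 (@complex.Re R)) /=.
  have -> : complex.Re (c * (\int[P]_w \1_B (Y w))%:C) =
     complex.Re c * \int[P]_w \1_B (Y w) by case: c {HW} => a b /=; ring.
  by move<-; apply: eq_Rintegral => w _; case: (W w) => a b /=; ring.
have HI B : measurable B -> \int[P]_w (complex.Im (W w) * \1_B (Y w)) =
    complex.Im c * \int[P]_w \1_B (Y w).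
  move=> /HW; rewrite C_expectationE => /(congr1 (@complex.Im R)) /=.
  have -> : complex.Im (c * (\int[P]_w \1_B (Y w))%:C) =
     complex.Im c * \int[P]_w \1_B (Y w) by case: c {HW HR} => a b /=; ring.
  by move<-; apply: eq_Rintegral => w _; case: (W w) => a b /=; ring.
have IRR := all_moments_L1M aW af mW1 mfY1 Re_nsq Re_nsq.
have IRI := all_moments_L1M aW af mW1 mfY2 Re_nsq Im_nsq.
have IIR := all_moments_L1M aW af mW2 mfY1 Im_nsq Re_nsq.
have III := all_moments_L1M aW af mW2 mfY2 Im_nsq Im_nsq.
have ERR := Rintegral_factor IW1 mY HR mf1 If1 IRR.
have ERI := Rintegral_factor IW1 mY HR mf2 If2 IRI.
have EIR := Rintegral_factor IW2 mY HI mf1 If1 IIR.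
have EII := Rintegral_factor IW2 mY HI mf2 If2 III.
rewrite !C_expectationE.
have -> : \int[P]_w complex.Re (W w * f (Y w)) =
   \int[P]_w (complex.Re (W w) * complex.Re (f (Y w)) -
              complex.Im (W w) * complex.Im (f (Y w))).
  by apply: eq_Rintegral => w _; case: (W w) => ? ?; case: (f _).
have -> : \int[P]_w complex.Im (W w * f (Y w)) =
   \int[P]_w (complex.Re (W w) * complex.Im (f (Y w)) +
              complex.Im (W w) * complex.Re (f (Y w))).
  by apply: eq_Rintegral => w _; case: (W w) => ? ?; case: (f _) => ? ? /=; ring.
rewrite RintegralB// RintegralD//.
move: ERR ERI EIR EII => /= -> -> -> ->.
case: c {HW HR HI} => a b; apply/eqP; rewrite eq_complex /=.
by apply/andP; split; apply/eqP; ring.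
Qed.

Section Product.
Variables (K : choiceType) (D : set K) (Y : K -> Om -> R[i]) (f : K -> R * R -> R[i]).
Hypothesis Y_indep : mutually_independent P D (fun k => sigma_rv (Y k)).
Hypothesis Y_rv : forall k, complex_rv (Y k).
Hypothesis f_meas : forall k, measurable_fun setT (C_to_R2 \o f k).
Let fY k w := f k (C_to_R2 (Y k w)).

Let C_expectation_prod_indic (s : seq K) (B : K -> set (R * R)) :
  uniq s -> (forall k, k \in s -> D k) -> (forall k, measurable (B k)) ->
  CE (fun w => \prod_(k <- s) (\1_(B k) (C_to_R2 (Y k w)) : R)%:C) =
  \prod_(k <- s) (\int[P]_w \1_(B k) (C_to_R2 (Y k w)))%:C.
Proof.
move=> us sD mB.
pose A k := (C_to_R2 \o Y k) @^-1` B k.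
have mA k : measurable (A k) by rewrite /A -[_ @^-1` _]setTI; exact: Y_rv.
have IA (C : set Om) : measurable C -> \int[P]_w \1_C w = fine (P C).
  by move=> mC; rewrite /Rintegral integral_indic// setIT.
have E : (fun w => \prod_(k <- s) (\1_(B k) (C_to_R2 (Y k w)) : R)%:C) =
    fun w => (\1_(\bigcap_(k in [set` s]) A k) w : R)%:C.
  apply/funext => w; rewrite -rmorph_prod; congr (_%:C).
  rewrite bigcap_seq; elim: (s) => [|k t IH]; first by rewrite !big_nil indicT.
  by rewrite !big_cons indicI /= IH.
rewrite E C_expectation_real IA; last first.
  by rewrite bigcap_seq; exact: bigsetI_measurable.
rewrite (Y_indep us) => [|k ks]; last first.
  by split; [exact: sD|exists (B k); rewrite ?setTI].
have -> : (\prod_(k <- s) P (A k) = (\prod_(k <- s) fine (P (A k)))%:E)%E.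
  rewrite -prodEFin; apply: eq_bigr => k _; rewrite fineK//.
  exact: fin_num_measure.
by rewrite rmorph_prod /=; apply: eq_bigr => k _; rewrite -IA.
Qed.

Lemma all_moments_indic (X : Om -> R[i]) (B : set (R * R)) :
  complex_rv X -> measurable B ->
  all_moments (fun w => (\1_B (C_to_R2 (X w)) : R)%:C).
Proof.
move=> mX mB; apply: (@all_moments_bounded _ 1).
  apply/complex_rvP; split; last exact: measurable_cst.
  by apply: measurableT_comp mX; exact: measurable_indic.
by move=> w; rewrite /nsq /= indicE; case: (_ \in _);
  rewrite ?expr1n ?expr0n ?addr0//.
Qed.

(* The factors are freed one at a time: while the variables of [s1] enter
   through [f], those of [s2] still enter through indicators, for which the
   formula is the definition of independence. To add [k] to [s1], the other
   factors are shown to be uncorrelated with each event on [Y k], which is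
   the induction hypothesis with [k] added to [s2]. *)
Let C_expectation_prod_aux (s1 s2 : seq K) (B : K -> set (R * R)) :
  uniq (s1 ++ s2) -> (forall k, k \in s1 ++ s2 -> D k) ->
  (forall k, k \in s1 -> all_moments (fY k)) -> (forall k, measurable (B k)) ->
  CE (fun w => \prod_(k <- s1) fY k w *
               \prod_(k <- s2) (\1_(B k) (C_to_R2 (Y k w)) : R)%:C) =
  \prod_(k <- s1) CE (fY k) *
  \prod_(k <- s2) (\int[P]_w \1_(B k) (C_to_R2 (Y k w)))%:C.
Proof.
elim: s1 s2 B => [|k s1 IH] s2 B us sD sf mB.
  rewrite big_nil mul1r -C_expectation_prod_indic//.
  by congr C_expectation; apply/funext => w; rewrite big_nil mul1r.
pose W w := \prod_(k <- s1) fY k w *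
  \prod_(k <- s2) (\1_(B k) (C_to_R2 (Y k w)) : R)%:C.
pose c := \prod_(k <- s1) CE (fY k) *
  \prod_(k <- s2) (\int[P]_w \1_(B k) (C_to_R2 (Y k w)))%:C.
have /= /andP[ks us'] := us.
have ks2 : k \notin s2 by apply: contraNN ks; rewrite mem_cat => ->; rewrite orbT.
have -> : (fun w => \prod_(k <- k :: s1) fY k w *
    \prod_(k <- s2) (\1_(B k) (C_to_R2 (Y k w)) : R)%:C) =
    fun w => W w * fY k w.
  by apply/funext => w; rewrite big_cons /W; ring.
rewrite big_cons -mulrA [RHS]mulrC.
have aW : all_moments W.
  apply: all_moments_mul; apply: all_moments_prod => i i1 _.
    by apply: sf; rewrite inE i1 orbT.
  exact: all_moments_indic.
have HW (B0 : set (R * R)) : measurable B0 ->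
    CE (fun w => W w * (\1_B0 (C_to_R2 (Y k w)) : R)%:C) =
    c * (\int[P]_w \1_B0 (C_to_R2 (Y k w)))%:C.
  move=> mB0; pose B' i := if i == k then B0 else B i.
  have B'B i : i \in s2 -> B' i = B i.
    by move=> i2; rewrite /B'; case: eqP i2 ks2 => [->->|//].
  have perm : perm_eq (s1 ++ k :: s2) (k :: s1 ++ s2).
    exact: (introT permPl (perm_catCA s1 [:: k] s2)).
  have E (F : K -> set (R * R) -> R[i]) :
      \prod_(i <- k :: s2) F i (B' i) = \prod_(i <- s2) F i (B i) * F k B0.
    rewrite big_cons {1}/B' eqxx mulrC; congr (_ * _).
    by apply: eq_big_seq => i /B'B ->.
  transitivity (CE (fun w => \prod_(i <- s1) fY i w *
      \prod_(i <- k :: s2) (\1_(B' i) (C_to_R2 (Y i w)) : R)%:C)).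
    congr C_expectation; apply/funext => w.
    by rewrite (E (fun i b => (\1_b (C_to_R2 (Y i w)))%:C)) mulrA.
  rewrite IH ?(perm_uniq perm)//.
  - by rewrite (E (fun i b => (\int[P]_w \1_b (C_to_R2 (Y i w)))%:C)) mulrA.
  - by move=> i; rewrite (perm_mem perm); exact: sD.
  - by move=> i i1; apply: sf; rewrite inE i1 orbT.
  - by move=> i; rewrite /B'; case: ifP.
apply: (C_expectation_factor aW (Y_rv k) HW (f_meas k)).
exact: sf (mem_head _ _).
Qed.

Lemma C_expectation_prod (s : seq K) :
  uniq s -> (forall k, k \in s -> D k) ->
  (forall k, k \in s -> all_moments (fun w => f k (C_to_R2 (Y k w)))) ->
  CE (fun w => \prod_(k <- s) f k (C_to_R2 (Y k w))) =
  \prod_(k <- s) CE (fun w => f k (C_to_R2 (Y k w))).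
Proof.
move=> us sD sf.
have := @C_expectation_prod_aux s [::] (fun=> setT); rewrite cats0 big_nil mulr1.
move=> <- //; congr C_expectation; apply/funext => w.
by rewrite big_nil mulr1.
Qed.

End Product.
End ComplexExpectation.

(** * Entries of Wigner matrices *)

Section Entries.
Context {R : realType}.

Lemma big_partition_seq (M : Type) (idx : M) (op : Monoid.com_law idx)
    (I K : eqType) (s : seq I) (h : I -> K) (r : seq K) (F : I -> M) :
  uniq r -> {subset map h s <= r} ->
  \big[op/idx]_(i <- s) F i =
  \big[op/idx]_(k <- r) \big[op/idx]_(i <- s | h i == k) F i.
Proof.
move=> ur sr; rewrite (exchange_big_dep xpredT)//= big_seq [RHS]big_seq.
apply: eq_bigr => i si.
rewrite (eq_bigl (fun k => k == h i)) => [|k]; last exact: eq_sym.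
by rewrite -big_filter filter_pred1_uniq ?sr ?map_f// big_seq1.
Qed.

Lemma same_law_Rintegral d (Om : measurableType d) (P : probability Om R)
    d' (Om' : measurableType d') (P' : probability Om' R)
    (X : Om -> R[i]) (X' : Om' -> R[i]) (g : R * R -> R) :
  complex_rv X -> complex_rv X' -> same_law P P' X X' ->
  measurable_fun setT g -> (forall u, 0 <= g u) ->
  \int[P]_w g (C_to_R2 (X w)) = \int[P']_w g (C_to_R2 (X' w)).
Proof.
move=> mX mX' XX' mg g0; congr fine.
have mg' : measurable_fun setT (EFin \o g) by exact/measurable_EFinP.
have g0' : {in [set: R * R], forall u, (0 <= (EFin \o g) u)%E}.
  by move=> u _; rewrite lee_fin.
have := ge0_integral_pushforward mX P measurableT mg' g0'.
have := ge0_integral_pushforward mX' P' measurableT mg' g0'.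
rewrite !preimage_setT /= => <- <-.
by apply: eq_measure_integral => B mB _; exact: XX'.
Qed.

Lemma nsq_normX (z : R[i]) m : complex.Re `|z| ^+ (m * 2)%N = nsq z ^+ m.
Proof. by rewrite mulnC exprM normc_def /= sqr_sqrtr ?nsq_ge0. Qed.

Section Moments.
Variables (d : nat -> measure_display) (Om : forall N, measurableType (d N)).
Variable P : forall N, probability (Om N) R.

Lemma wigner_all_moments (x : forall N, Om N -> 'M[R[i]]_N) N (i k : 'I_N) :
  wigner P x -> all_moments (P N) (fun w => x N w i k).
Proof.
move=> wx; split; first exact: (wigner_rv wx).
move=> m; have := wigner_moments wx i k (m * 2).
rewrite unlock; under eq_integral do rewrite nsq_normX.
have /complex_rvP[mR mI] := wigner_rv wx i k.
move=> H; apply/integrableP; split.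
  apply/measurable_EFinP.
  by apply: measurable_funX; apply: measurable_funD; apply: measurable_funX.
apply: le_lt_trans H; rewrite le_eqVlt; apply/orP; left; apply/eqP.
by apply: eq_integral => w _ /=; rewrite ger0_norm// exprn_ge0// nsq_ge0.
Qed.

(** Up to conjugation, every entry has the law of the diagonal entry of the
    matrix of size 1 or of the subdiagonal entry of the matrix of size 2, so
    that the moments of these two entries bound all others. *)
Lemma wigner_moment_bound (x : forall N, Om N -> 'M[R[i]]_N) (m : nat) :
  wigner P x -> exists C : R, forall N (i k : 'I_N),
    \int[P N]_w nsq (x N w i k) ^+ m <= C.
Proof.
move=> wx; pose M N (i k : 'I_N) := \int[P N]_w nsq (x N w i k) ^+ m.
have M0 N (i k : 'I_N) : 0 <= M N i k.
  by apply: Rintegral_ge0 => w _; rewrite exprn_ge0// nsq_ge0.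
pose g (u : R * R) := (u.1 ^+ 2 + u.2 ^+ 2) ^+ m.
have mg : measurable_fun setT g.
  by apply: measurable_funX; apply: measurable_funD; apply: measurable_funX.
have g0 u : 0 <= g u by rewrite exprn_ge0// addr_ge0// sqr_ge0.
have law N N' (i k : 'I_N) (i' k' : 'I_N') :
    same_law (P N) (P N') (fun w => x N w i k) (fun w => x N' w i' k') ->
    M N i k = M N' i' k'.
  by move=> H; apply: (same_law_Rintegral _ _ H mg g0); exact: (wigner_rv wx).
exists (M 1%N ord0 ord0 + M 2%N (lift ord0 ord0) ord0) => N i k; rewrite -/(M N i k).
have low (a b : 'I_N) : (b < a)%N -> M N a b = M 2%N (lift ord0 ord0) ord0.
  by move=> ab; apply: law; exact: (wigner_offdiag_law wx).
case: (ltngtP i k) => [ik|ki|/ord_inj ik].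
- have -> : M N i k = M N k i.
    by apply: eq_Rintegral => w _; rewrite (wigner_hermitian wx) nsq_conj.
  by rewrite low// lerDr.
- by rewrite low// lerDr.
- by rewrite ik (law N 1%N k k ord0 ord0 (wigner_diag_law wx k ord0)) lerDl.
Qed.

End Moments.

Lemma sigma_bigcap (T : pointedType) (G : set (set T)) (I : choiceType) (s : seq I)
    (B : I -> set T) : (forall i, i \in s -> G (B i)) ->
  <<s G >> (\bigcap_(i in [set` s]) B i).
Proof.
move=> GB; rewrite bigcap_seq big_seq.
apply: (@bigsetI_measurable _ (g_sigma_algebraType G)) => i si.
by apply: sub_gen_smallest; exact: GB.
Qed.

(** Independence inside each matrix and independence across the matrices combine:
    a finite family of events on entries is grouped by matrices, each group
    being an event of the sigma-algebra of its matrix. *)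
Lemma entries_indep d (Om : measurableType d) (P : probability Om R)
    (J : choiceType) N (x : J -> Om -> 'M[R[i]]_N) :
  (forall j, mutually_independent P [set p : 'I_N * 'I_N | (p.2 <= p.1)%N]
    (fun p => sigma_rv (fun w => x j w p.1 p.2))) ->
  mutually_independent P [set: J] (fun j => sigma_mx (x j)) ->
  mutually_independent P [set k : J * ('I_N * 'I_N) | (k.2.2 <= k.2.1)%N]
    (fun k => sigma_rv (fun w => x k.1 w k.2.1 k.2.2)).
Proof.
move=> indep_in indep_across s B us sB.
pose js := undup (map fst s).
pose ps j := [seq k.2 | k <- s & k.1 == j].
pose C j := \bigcap_(p in [set` ps j]) B (j, p).
have psP j p : (p \in ps j) = ((j, p) \in s).
  apply/mapP/idP => [[[j' p']]|jp].
    by rewrite mem_filter /= => /andP[/eqP <- ?] ->.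
  by exists (j, p) => //; rewrite mem_filter /= eqxx.
have ups j : uniq (ps j).
  rewrite map_inj_in_uniq ?filter_uniq// => -[j1 p1] [j2 p2].
  by rewrite !mem_filter /= => /andP[/eqP-> _] /andP[/eqP-> _] ->.
have -> : \bigcap_(k in [set` s]) B k = \bigcap_(j in [set` js]) C j.
  apply/seteqP; split => w H.
    by move=> j _ p /=; rewrite psP => jp; exact: (H (j, p)).
  move=> [j p] /= jps; apply: (H j) => /=; last by rewrite psP.
  by rewrite mem_undup; apply/mapP; exists (j, p).
rewrite indep_across ?undup_uniq// => [|j _]; last first.
  split=> //; rewrite /sigma_mx.
  apply: sigma_bigcap => p; rewrite psP => /sB[_ H].
  by exists p.
rewrite (@big_partition_seq _ _ _ _ _ s fst js) ?undup_uniq//; last first.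
  by move=> j; rewrite mem_undup.
apply: eq_bigr => j _; rewrite (indep_in j (ps j) (fun p => B (j, p)))//.
  rewrite big_map big_filter; apply: eq_bigr => -[j' p] /= /eqP -> //.
by move=> p; rewrite psP => /sB.
Qed.

End Entries.

(** * Factorization along blocks *)

Section EdgeProducts.
Context {R : realType} (J : choiceType) (T : test_graph J).
Context d (Om : measurableType d) (P : probability Om R) (N : nat).
Variable x : J -> Om -> 'M[R[i]]_N.
Hypothesis x_indep :
  mutually_independent P [set k : J * ('I_N * 'I_N) | (k.2.2 <= k.2.1)%N]
    (fun k => sigma_rv (fun w => x k.1 w k.2.1 k.2.2)).
Hypothesis x_moments : forall j i k, all_moments P (fun w => x j w i k).
Hypothesis x_hermitian : forall j w i k, x j w i k = (x j w k i)^*.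
Variable phi : {ffun tg_vertex T -> 'I_N}.
Hypothesis phi_inj : injective phi.

Local Notation V := (tg_vertex T).
Local Notation E := (tg_edge T).
Implicit Types e : E.

Definition edge_entry e (w : Om) : R[i] :=
  x (tg_label e) w (phi (tg_tgt e)) (phi (tg_src e)).

(** By Hermitian symmetry only the entries [(i, k)] with [k <= i] are independent
    variables; [entry_key e] is the one seen by [e], which is conjugated
    when [e] is not descending. *)
Definition descending e : bool := (phi (tg_src e) <= phi (tg_tgt e))%N.

Definition entry_key e : J * ('I_N * 'I_N) :=
  (tg_label e, if descending e then (phi (tg_tgt e), phi (tg_src e))
               else (phi (tg_src e), phi (tg_tgt e))).

Lemma entry_key_lower e : ((entry_key e).2.2 <= (entry_key e).2.1)%N.
Proof.
by rewrite /entry_key; case: ifP => //= /negbT; rewrite -ltnNge => /ltnW.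
Qed.

(** Injectivity of the labelling makes the grouping of edges by independent
    entries depend on the graph alone. *)
Lemma entry_keyP e e' : (entry_key e' == entry_key e) = (e' \in block e).
Proof.
rewrite inE /entry_key xpair_eqE; congr (_ && _).
rewrite /ends set2_eq -!(inj_eq phi_inj) -!val_eqE /= /descending.
by do 2 case: leqP => ?; rewrite xpair_eqE -!val_eqE /=; lia.
Qed.

Definition orient e (z : R[i]) : R[i] := if descending e then z else z^*.

Lemma edge_entry_orient e w : edge_entry e w =
  orient e (x (entry_key e).1 w (entry_key e).2.1 (entry_key e).2.2).
Proof.
rewrite /edge_entry /orient /entry_key; case: (descending e) => //=.
Qed.

Lemma edge_entry_moments e : all_moments P (edge_entry e).
Proof. exact: x_moments. Qed.

(** The product of the entries seen by the edges with key [k], as a function of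
    the coordinates of the single variable on which they all depend. *)
Definition key_monomial (k : J * ('I_N * 'I_N)) (u : R * R) : R[i] :=
  \prod_(e | entry_key e == k) orient e (u.1 +i* u.2).

Lemma key_monomialE k w : key_monomial k (C_to_R2 (x k.1 w k.2.1 k.2.2)) =
  \prod_(e | entry_key e == k) edge_entry e w.
Proof.
apply: eq_bigr => e /eqP <-; rewrite edge_entry_orient.
by rewrite /C_to_R2 /=; case: (x _ _ _ _).
Qed.

Lemma key_monomial_measurable k : measurable_fun setT (C_to_R2 \o key_monomial k).
Proof.
apply: (@complex_rv_prod R _ (R * R)%type) => e; rewrite /orient.
have mid : complex_rv (fun u : R * R => u.1 +i* u.2).
  by apply/complex_rvP; split; [exact: measurable_fst|exact: measurable_snd].
by case: (descending e) => //; exact: complex_rv_conj.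
Qed.

Lemma big_keys_blocks (G : {set E} -> R[i]) :
  \prod_(k <- undup (map entry_key (enum E))) G [set e | entry_key e == k]%SET =
  \prod_(q in blocks T) G q.
Proof.
pose h k := [set e | entry_key e == k]%SET.
have hb e : h (entry_key e) = block e.
  by apply/finset.setP => e'; rewrite inE entry_keyP.
rewrite -(big_map h predT G) -[RHS]big_enum /=; apply: perm_big.
apply: uniq_perm; rewrite ?enum_uniq//.
  rewrite map_inj_in_uniq ?undup_uniq// => k k'.
  rewrite !mem_undup => /mapP[e _ ->] /mapP[e' _ ->].
  by rewrite !hb => bb; apply/eqP; rewrite entry_keyP -bb mem_block.
move=> q; rewrite mem_enum; apply/mapP/imsetP => [[k]|[e _ ->]].
  by rewrite mem_undup => /mapP[e _ ->] ->; exists e.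
by exists (entry_key e); rewrite ?hb// mem_undup map_f ?mem_enum.
Qed.

Lemma edge_product_blocks :
  C_expectation P (fun w => \prod_e edge_entry e w) =
  \prod_(q in blocks T) C_expectation P (fun w => \prod_(e in q) edge_entry e w).
Proof.
pose ks := undup (map entry_key (enum E)).
have -> : (fun w => \prod_e edge_entry e w) = fun w =>
    \prod_(k <- ks) key_monomial k (C_to_R2 (x k.1 w k.2.1 k.2.2)).
  apply/funext => w; rewrite (@big_partition_seq _ _ _ _ _ _ entry_key ks).
  - by apply: eq_bigr => k _; rewrite key_monomialE.
  - exact: undup_uniq.
  - by move=> k /mapP[e _ ->]; rewrite mem_undup map_f// mem_enum.
rewrite (C_expectation_prod (Y := fun k w => x k.1 w k.2.1 k.2.2) x_indep).
- rewrite -big_keys_blocks; apply: eq_bigr => k _; congr C_expectation.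
  apply/funext => w; rewrite key_monomialE; apply: eq_bigl => e.
  by rewrite inE.
- by move=> k; have [] := x_moments k.1 k.2.1 k.2.2.
- exact: key_monomial_measurable.
- exact: undup_uniq.
- by move=> k; rewrite mem_undup => /mapP[e _ ->]; exact: entry_key_lower.
- move=> k _; under eq_fun do rewrite key_monomialE.
  by apply: all_moments_prod => e _ _; exact: edge_entry_moments.
Qed.

End EdgeProducts.

(** * The expectation for one injective labelling *)

(** The product is at most the power of its largest factor. *)
Lemma prod_le_sum_pow (R : realDomainType) (I : finType) (a : I -> R) :
  (forall i, 0 <= a i) -> \prod_i a i <= 1 + \sum_i a i ^+ #|I|.
Proof.
move=> a0; have s0 : 0 <= \sum_i a i ^+ #|I|.
  by apply: sumr_ge0 => i _; rewrite exprn_ge0.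
case: (pickP (fun _ : I => true)) => [i0 _|I0]; last by rewrite big_pred0// lerDl.
case: (@arg_maxP _ _ I i0 xpredT a isT) => i _ iM.
apply: (@le_trans _ _ (\prod_(j : I) a i)).
  by apply: ler_prod => j _; rewrite a0 /=; exact: iM.
rewrite prodr_const (bigD1 i)//= addrCA lerDl.
by rewrite addr_ge0// sumr_ge0// => j _; rewrite exprn_ge0.
Qed.

Lemma normc_le (R : realType) (z : R[i]) :
  `|z| <= (`|complex.Re z| + `|complex.Im z|)%:C.
Proof.
rewrite normc_def lecR -[leRHS]ger0_norm ?addr_ge0// -sqrtr_sqr ler_wsqrtr//.
rewrite sqrrD !real_normK ?num_real// lerD2r lerDl mulrn_wge0// mulr_ge0//.
Qed.

Section Evaluation.
Context {R : realType} (J : choiceType) (T : test_graph J).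
Context d (Om : measurableType d) (P : probability Om R) (N : nat).
Variable x : J -> Om -> 'M[R[i]]_N.
Hypothesis x_indep :
  mutually_independent P [set k : J * ('I_N * 'I_N) | (k.2.2 <= k.2.1)%N]
    (fun k => sigma_rv (fun w => x k.1 w k.2.1 k.2.2)).
Hypothesis x_moments : forall j i k, all_moments P (fun w => x j w i k).
Hypothesis x_hermitian : forall j w i k, x j w i k = (x j w k i)^*.
Variable phi : {ffun tg_vertex T -> 'I_N}.
Hypothesis phi_inj : injective phi.

Local Notation E := (tg_edge T).
Local Notation CE := (C_expectation P).
Local Notation X := (edge_entry x phi).

Lemma norm_C_expectation_le (Z : Om -> R[i]) : all_moments P Z ->
  `|CE Z| <= (2 * (1 + \int[P]_w nsq (Z w)))%:C.
Proof.
move=> aZ; apply: le_trans (normc_le _) _; rewrite lecR C_expectationE /=.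
have [IR II] := all_moments_integrable aZ.
have IN : P.-integrable setT (EFin \o (fun w => nsq (Z w))).
  by apply: eq_integrable (aZ.2 1%N) => // w _ /=; rewrite expr1.
have IZ := L1_add (L1_cst P 1) IN.
have I1 : 1 + \int[P]_w nsq (Z w) = \int[P]_w (1 + nsq (Z w)).
  by rewrite (RintegralD measurableT (L1_cst P 1) IN) Rintegral_cst1.
rewrite I1 mulrDl mul1r; apply: lerD; apply: le_trans (le_normr_Rintegral _ _) _ => //.
- apply: le_Rintegral => //; first exact: (integrable_abse IR).
  move=> w _; have := Re_nsq (Z w); move: (complex.Re _) (nsq _) => a b.
  by rewrite ler_norml; nra.
- apply: le_Rintegral => //; first exact: (integrable_abse II).
  move=> w _; have := Im_nsq (Z w); move: (complex.Im _) (nsq _) => a b.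
  by rewrite ler_norml; nra.
Qed.

Lemma nsq_prod (I : Type) (s : seq I) (Q : pred I) (z : I -> R[i]) :
  nsq (\prod_(i <- s | Q i) z i) = \prod_(i <- s | Q i) nsq (z i).
Proof.
by apply: (big_morph (@nsq R)) => [a b|]; rewrite ?nsqM// /nsq /= expr1n expr0n addr0.
Qed.

(** The mean is controlled by the second moment, and a product of [#|E|] factors
    by the sum of their [#|E|]-th powers. The bound does not depend on the
    labelling, nor on the size when [C] does not. *)
Lemma edge_product_bound (C : J -> R) :
  (forall j i k, \int[P]_w nsq (x j w i k) ^+ #|E| <= C j) ->
  `|CE (fun w => \prod_e X e w)| <= (2 * (2 + \sum_(e : E) C (tg_label e)))%:C.
Proof.
move=> xC; have aX : all_moments P (fun w => \prod_e X e w).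
  by apply: all_moments_prod => e _ _; exact: x_moments.
apply: le_trans (norm_C_expectation_le aX) _; rewrite lecR ler_pM2l// -addrA lerD2l.
have [IS ES] := Rintegral_sum (P := P) (index_enum E) (Q := xpredT)
  (f := fun e w => nsq (X e w) ^+ #|E|)
  (fun e _ => (x_moments (tg_label e) (phi (tg_tgt e)) (phi (tg_src e))).2 #|E|).
apply: (@le_trans _ _ (\int[P]_w (1 + \sum_e nsq (X e w) ^+ #|E|))).
  apply: le_Rintegral => //.
  - by apply: eq_integrable (aX.2 1%N) => // w _ /=; rewrite expr1.
  - by apply: L1_add => //; exact: L1_cst.
  - move=> w _; rewrite nsq_prod; apply: prod_le_sum_pow => e; exact: nsq_ge0.
rewrite (RintegralD measurableT (L1_cst P 1) IS) Rintegral_cst1 lerD2l ES.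
by apply: ler_sum => e _; exact: xC.
Qed.

(** A block with a single edge contributes the mean of an entry, which is 0. *)
Lemma edge_product_centered q :
  (forall j i k, CE (fun w => x j w i k) = 0) ->
  q \in blocks T -> (#|q| <= 1)%N -> CE (fun w => \prod_e X e w) = 0.
Proof.
move=> x0 qT q1; rewrite (edge_product_blocks x_indep)//; apply/eqP.
apply/prodf_eq0; exists q => //.
have [e _ qe] := imsetP qT.
have {}q1 : q = [set e]%SET.
  apply/eqP; rewrite eq_sym eqEcard cards1 q1 andbT finset.sub1set qe mem_block //.
rewrite q1; under eq_fun do rewrite big_set1.
by rewrite x0.
Qed.

(** In a colored double tree a block is a pair of twins. With opposite
    orientations the entry is multiplied by its conjugate, with the same
    orientation by itself; the entry is off the diagonal since a tree has no
    loop. On the right, only the factor of the common label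
    of the twins can differ from 1. *)
Lemma block_expectation (alpha beta : J -> R[i]) q :
  (forall j i k, i != k -> CE (fun w => `|x j w i k| ^+ 2) = alpha j /\
     CE (fun w => x j w i k ^+ 2) = beta j) ->
  colored_double_tree T -> q \in blocks T ->
  CE (fun w => \prod_(e in q) X e w) =
  \prod_(j <- labels T)
    (alpha j ^+ (q \in twin_pairs (@opposite_orientation J T) j) *
     beta j ^+ (q \in twin_pairs (@same_orientation J T) j)).
Proof.
move=> xab cT /imsetP[e _ ->].
have [e' tee [-> ll]] := colored_double_tree_block e cT.
have /andP[ne _] := tee.
have loop : phi (tg_tgt e) != phi (tg_src e).
  by rewrite (inj_eq phi_inj) eq_sym; case: cT => -[tT _] _; exact: tree_no_loop.
have [Ea Eb] := xab (tg_label e) _ _ loop.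
under eq_fun do rewrite (big_setU1 _ _) ?inE//= big_set1.
have pick_label (F : J -> R[i]) :
    \prod_(j <- labels T) F j ^+ (tg_label e == j) = F (tg_label e).
  rewrite (eq_bigr (fun j => if j == tg_label e then F j else 1)) => [|j _]; last first.
    by rewrite eq_sym; case: eqP.
  rewrite -big_mkcond -big_filter filter_pred1_uniq ?undup_uniq ?big_seq1//.
  by rewrite mem_undup map_f// mem_enum.
have excl : same_orientation e e' = ~~ opposite_orientation e e'.
  move: tee => /andP[_]; rewrite /same_endpoints.
  case: (boolP (opposite_orientation e e')) => [/andP[/eqP o1 /eqP o2] _|_]; last first.
    by rewrite orbF.
  apply/negbTE/negP => /andP[/eqP s1 _].
  by move: loop; rewrite o2 -s1 eqxx.
under [RHS]eq_bigr => j _.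
  rewrite (mem_twin_pairs _ (@opposite_orientation_sym _ T))//.
  rewrite (mem_twin_pairs _ (@same_orientation_sym _ T))// excl.
  over.
case: (boolP (opposite_orientation e e')) => [/andP[/eqP o1 /eqP o2]|so].
- under [RHS]eq_bigr => j _ do rewrite andbT andbF expr0 mulr1.
  rewrite pick_label -Ea; congr C_expectation; apply/funext => w.
  by rewrite /edge_entry ll o2 -o1 [x _ _ (phi (tg_src e)) _]x_hermitian -sqr_normc.
- under [RHS]eq_bigr => j _ do rewrite andbT andbF expr0 mul1r.
  rewrite pick_label -Eb; congr C_expectation; apply/funext => w.
  move: so; rewrite -excl => /andP[/eqP s1 /eqP s2].
  by rewrite /edge_entry ll s1 s2 expr2.
Qed.

Lemma edge_product_double_tree (alpha beta : J -> R[i]) :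
  (forall j i k, i != k -> CE (fun w => `|x j w i k| ^+ 2) = alpha j /\
     CE (fun w => x j w i k ^+ 2) = beta j) ->
  colored_double_tree T ->
  CE (fun w => \prod_e X e w) =
  \prod_(j <- labels T) (alpha j ^+ twins_opposite T j * beta j ^+ twins_same T j).
Proof.
move=> xab cT; rewrite (edge_product_blocks x_indep)//.
under eq_bigr => q qT do rewrite (block_expectation xab cT qT).
rewrite exchange_big /=; apply: eq_bigr => j _; rewrite big_split /=.
have count (o : rel E) (a : R[i]) :
    \prod_(q in blocks T) a ^+ (q \in twin_pairs o j) = a ^+ #|twin_pairs o j|.
  rewrite (eq_bigr (fun q => if q \in twin_pairs o j then a else 1));
    last by move=> q _; case: ifP.
  rewrite -big_mkcondr /= -prodr_const; apply: eq_bigl => q.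
  by rewrite andb_idl// => /(fintype.subsetP (twin_pairs_sub o j cT)).
by rewrite !count.
Qed.

End Evaluation.

(** * The large size limit *)

Section Limits.
Context {R : realType}.

Lemma complex_squeeze (f : nat -> R[i]^o) (l : R[i]^o) (u : nat -> R) :
  (forall n, `|l - f n| <= (u n)%:C) -> u @ \oo --> 0 -> f @ \oo --> l.
Proof.
move=> fu u0; apply/cvgrPdist_lt => eps eps0.
have [e e0 ->] : exists2 e : R, 0 < e & eps = e%:C.
  move: eps0; case: eps => a b; rewrite ltcE /= => /andP[/eqP -> a0].
  by exists a.
move/cvgrPdist_lt : u0 => /(_ e e0); apply: filterS => n un.
apply: le_lt_trans (fu n) _; rewrite ltcR.
by apply: le_lt_trans un; rewrite sub0r normrN ler_norm.
Qed.

Lemma inv_sqrt_cvg0 : (fun n => (Num.sqrt n.+1%:R)^-1 : R) @ \oo --> 0.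
Proof.
have -> : (fun n => (Num.sqrt n.+1%:R)^-1 : R) = Num.sqrt \o (@harmonic R).
  by apply/funext => n; rewrite /= sqrtrV.
rewrite -[X in _ --> X](@sqrtr0 R).
by apply: continuous_cvg; [exact: sqrt_continuous|exact: cvg_harmonic].
Qed.

Lemma ffact_le_exp n k : (n ^_ k <= n ^ k)%N.
Proof. by elim: k => // k IH; rewrite ffactnSr expnSr leq_mul// leq_subr. Qed.

Lemma ffact_ratio_cvg1 k :
  (fun n => (n.+1 ^_ k)%:R / n.+1%:R ^+ k : R) @ \oo --> (1 : R).
Proof.
elim: k => [|k IH].
  under eq_fun do rewrite ffactn0 expr0 divr1; exact: cvg_cst.
have step : (fun n => (n.+1 - k)%:R / n.+1%:R : R) @ \oo --> (1 : R).
  apply: (@squeeze_cvgr _ _ _ _ (fun n => 1 - k%:R * harmonic n) (fun=> 1)).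
  - apply: nearW => n; have n0 : 0 < n.+1%:R :> R by rewrite ltr0n.
    rewrite ler_pdivrMr// ler_pdivlMr// mul1r ler_nat leq_subr andbT.
    rewrite mulrBl mul1r -mulrA /harmonic mulVf ?gt_eqF// mulr1 lerBlDr -natrD ler_nat.
    by lia.
  - rewrite -[X in _ --> X]subr0; apply: cvgB; first exact: cvg_cst.
    rewrite -[X in _ --> X](mulr0 (k%:R : R)); apply: cvgMr; exact: cvg_harmonic.
  - exact: cvg_cst.
have -> : (fun n => (n.+1 ^_ k.+1)%:R / n.+1%:R ^+ k.+1 : R) =
    fun n => ((n.+1 ^_ k)%:R / n.+1%:R ^+ k) * ((n.+1 - k)%:R / n.+1%:R).
  by apply/funext => n; rewrite ffactnSr natrM exprSr invfM mulrACA.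
by rewrite -[X in _ --> X](mulr1 1); apply: cvgM.
Qed.

End Limits.

Section WignerFamily.
Context (R : realType) (d : nat -> measure_display)
  (Om : forall N : nat, measurableType (d N))
  (P : forall N : nat, probability (Om N) R)
  (J : choiceType) (x : J -> forall N : nat, Om N -> 'M[R[i]]_N)
  (alpha beta : J -> R[i]).
Arguments x : clear implicits.
Hypotheses (x_wigner : forall j, wigner P (x j))
  (x_indep : forall N, mutually_independent (P N) [set: J]
     (fun j => sigma_mx (x j N)))
  (x_param : forall j, wigner_parameter P (x j) (alpha j) (beta j)).
Variable T : test_graph J.

Local Notation V := (tg_vertex T).
Local Notation E := (tg_edge T).
Local Notation tauN := (tau0 P (fun j => normalized (x j)) T).
Local Notation moment N phi :=
  (C_expectation (P N) (fun w => \prod_e edge_entry (T := T) (fun j => x j N) phi e w)).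

(** The factor [1 / N] times one [1 / sqrt N] for each edge. *)
Definition scaling N : R := N%:R^-1 * (Num.sqrt N%:R)^-1 ^+ #|E|.

Lemma tau0E N : tauN N =
  (scaling N)%:C * \sum_(phi : {ffun V -> 'I_N} | injectiveb phi) moment N phi.
Proof.
have am (phi : {ffun V -> 'I_N}) (_ : injectiveb phi) : C_integrable (P N)
    (fun w => \prod_e edge_entry (T := T) (fun j => x j N) phi e w).
  apply: all_moments_integrable; apply: all_moments_prod => e _ _.
  exact: wigner_all_moments.
have [I1 <-] := C_expectation_sum (index_enum _) am.
have [_ <-] := C_expectation_scale (scaling N)%:C I1.
rewrite /tau0; congr C_expectation; apply/funext => w.
rewrite /scaling rmorphM fmorphV rmorph_nat -mulrA; congr (_ * _).
rewrite mulr_sumr; apply: eq_bigr => phi _.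
rewrite rmorphXn /= -prodr_const -big_split /=; apply: eq_bigr => e _.
by rewrite /normalized mxE.
Qed.

Let joint_indep N := entries_indep
  (fun j => @wigner_indep R d Om P (x j) (x_wigner j) N) (@x_indep N).

Let moments N j i k := @wigner_all_moments R d Om P (x j) N i k (x_wigner j).

Let herm N j w i k := @wigner_hermitian R d Om P (x j) (x_wigner j) N w i k.

Lemma sqrt_exp n k : Num.sqrt n%:R ^+ (2 * k) = n%:R ^+ k :> R.
Proof. by rewrite exprM sqr_sqrtr. Qed.

(** There are at most [N ^ #|V|] labellings, with bounded contributions, and
    [N ^ #|V|] times the scaling is [sqrt N] to the power
    [2 #|V| - 2 - #|E| <= - 1]. *)
Lemma tau0_degenerate : ~ (#|E| + 2 <= 2 * #|V|)%N ->
  (tauN : nat -> R[i]^o) @ \oo --> (0 : R[i]^o).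
Proof.
move=> EV.
have [C HC] : exists C : J -> R, forall j N (i k : 'I_N),
    \int[P N]_w nsq (x j N w i k) ^+ #|E| <= C j.
  have /choice[C HC] j := wigner_moment_bound #|E| (x_wigner j).
  by exists C => j N i k; exact: HC.
pose B := 2 * (2 + \sum_(e : E) C (tg_label e)).
(* Sizes are shifted by one so that the size is never 0. *)
rewrite -(cvg_shiftS (tauN : nat -> R[i]^o)).
apply: (@complex_squeeze _ _ _ (fun n => B * (Num.sqrt n.+1%:R)^-1)); last first.
  by rewrite -[X in _ --> X](mulr0 B); apply: cvgMr; exact: inv_sqrt_cvg0.
move=> n; rewrite sub0r normrN /= tau0E normrM.
set s := Num.sqrt n.+1%:R.
have s1 : 1 <= s by rewrite -sqrtr1 ler_wsqrtr// ler1n.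
have s0 : 0 < s by exact: lt_le_trans s1.
have sc0 : 0 <= scaling n.+1.
  by rewrite /scaling mulr_ge0 ?invr_ge0// exprn_ge0// invr_ge0 ltW.
have bound (phi : {ffun V -> 'I_n.+1}) : injectiveb phi -> `|moment n.+1 phi| <= B%:C.
  move=> /injectiveP phi_inj.
  by apply: (edge_product_bound (moments (N := n.+1))) => j i k; exact: HC.
have B0 : 0 <= B.
  rewrite /B mulr_ge0// addr_ge0// sumr_ge0// => e _.
  apply: (le_trans _ (HC (tg_label e) 1%N ord0 ord0)).
  by apply: Rintegral_ge0 => w _; rewrite exprn_ge0// nsq_ge0.
have sum_le : `|\sum_(phi : {ffun V -> 'I_n.+1} | injectiveb phi) moment n.+1 phi|
    <= (B * n.+1%:R ^+ #|V|)%:C.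
  apply: le_trans (ler_norm_sum _ _ _) _.
  apply: (@le_trans _ _ (\sum_(phi : {ffun V -> 'I_n.+1} | injectiveb phi) B%:C)).
    by apply: ler_sum => phi; exact: bound.
  rewrite sumr_const -[X in X <= _]rmorphMn lecR -[leLHS]mulr_natr ler_wpM2l//.
  rewrite -natrX ler_nat; apply: leq_trans (ffact_le_exp _ _).
  have := card_inj_ffuns V 'I_n.+1; rewrite card_ord cardsE => ->.
  exact: leqnn.
rewrite ger0_norm; last by rewrite lecR.
apply: (@le_trans _ _ ((scaling n.+1)%:C * (B * n.+1%:R ^+ #|V|)%:C)).
  by rewrite ler_wpM2l// lecR.
rewrite -rmorphM lecR mulrCA ler_wpM2l// /scaling -(sqrt_exp _ #|V|) -/s.
have -> : n.+1%:R^-1 = s^-1 ^+ 2 by rewrite exprVn sqr_sqrtr.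
have [c Ec] : exists c, (2 + #|E| = 2 * #|V| + c.+1)%N.
  by exists (#|E| + 1 - 2 * #|V|)%N; lia.
rewrite -exprD Ec exprD mulrAC -exprMn mulVf ?gt_eqF// expr1n mul1r exprS.
by rewrite ler_piMr ?invr_ge0 ?(ltW s0)// exprn_ile1 ?invr_ge0 ?(ltW s0)// invf_le1.
Qed.

Lemma tau0_singleton_block q : q \in blocks T -> (#|q| <= 1)%N ->
  (tauN : nat -> R[i]^o) @ \oo --> (0 : R[i]^o).
Proof.
move=> qT q1.
have -> : tauN = fun=> 0; last exact: cvg_cst.
apply/funext => N; rewrite tau0E big1 ?mulr0// => phi /injectiveP phi_inj.
apply: (edge_product_centered (joint_indep (N := N)) (moments (N := N))
  (herm (N := N)) phi_inj _ qT q1) => j i k.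
exact: (wigner_centered (x_wigner j)).
Qed.

(** All labellings contribute the same value, and since [#|E| + 2 = 2 #|V|] their
    number times the scaling is [N ^_ #|V| / N ^ #|V|], which tends to 1. *)
Lemma tau0_colored_double_tree : colored_double_tree T ->
  (tauN : nat -> R[i]^o) @ \oo -->
  (\prod_(j <- labels T)
     (alpha j ^+ twins_opposite T j * beta j ^+ twins_same T j) : R[i]^o).
Proof.
move=> cT; set v := \prod_(j <- _) _.
have EV := double_tree_card cT.1.
rewrite -(cvg_shiftS (tauN : nat -> R[i]^o)).
pose r n : R := (n.+1 ^_ #|V|)%:R / n.+1%:R ^+ #|V|.
have tauE n : tauN n.+1 = (r n)%:C * v.
  rewrite tau0E (eq_bigr (fun=> v)) => [|phi /injectiveP phi_inj]; last first.
    apply: (edge_product_double_tree (joint_indep (N := n.+1)) (moments (N := n.+1))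
      (herm (N := n.+1)) phi_inj _ cT) => j i k ik.
    exact: (x_param j ik).
  rewrite sumr_const.
  have := card_inj_ffuns V 'I_n.+1; rewrite card_ord cardsE => ->.
  rewrite -mulr_natl mulrA; congr (_ * _).
  rewrite -(rmorph_nat (real_complex R)) -rmorphM; congr (_%:C).
  rewrite /r /scaling mulrC; congr (_ * _).
  have -> : n.+1%:R^-1 = (Num.sqrt n.+1%:R)^-1 ^+ 2 :> R by rewrite exprVn sqr_sqrtr.
  by rewrite -exprD exprVn [(2 + _)%N]addnC EV sqrt_exp.
under eq_fun do rewrite tauE.
apply: (@complex_squeeze _ _ _
  (fun n => `|1 - r n| * (`|complex.Re v| + `|complex.Im v|))) => [n|].
  have -> : v - (r n)%:C * v = (1 - r n)%:C * v.
    by rewrite rmorphB rmorph1 mulrBl mul1r.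
  rewrite [leLHS](normrM (R := R[i])) rmorphM normc_def /= expr0n addr0 sqrtr_sqr.
  by apply: ler_wpM2l; [rewrite lecR|exact: normc_le].
rewrite -[X in _ --> X](mul0r (`|complex.Re v| + `|complex.Im v|)).
apply: cvgMl; rewrite -[X in _ --> X](@normr0 _ R); apply: cvg_norm.
rewrite -[X in _ --> X](subrr (1 : R)); apply: cvgB; first exact: cvg_cst.
exact: ffact_ratio_cvg1.
Qed.

End WignerFamily.

Theorem proposition3p1 (R : realType) (d : nat -> measure_display)
  (Om : forall N : nat, measurableType (d N))
  (P : forall N : nat, probability (Om N) R)
  (J : choiceType) (x : J -> forall N : nat, Om N -> 'M[R[i]]_N)
  (alpha beta : J -> R[i])
  (x_wigner : forall j, wigner P (x j))
  (x_indep : forall N, mutually_independent (P N) [set: J]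
     (fun j => sigma_mx (x j N)))
  (x_conj : forall j, conj_invariant P (x j))
  (x_param : forall j, wigner_parameter P (x j) (alpha j) (beta j)) :
  has_limiting_traffic_distribution P (fun j => normalized (x j)) /\
  forall T : test_graph J,
    (tau0 P (fun j => normalized (x j)) T : nat -> R[i]^o) @ \oo -->
    ((`[< colored_double_tree T >])%:R *
     \big[*%R/1]_(j \in [set: J])
       (alpha j ^+ twins_opposite T j * beta j ^+ twins_same T j) : R[i]^o).
Proof.
pose limit (T : test_graph J) : R[i]^o := (`[< colored_double_tree T >])%:R *
  \big[*%R/1]_(j \in [set: J])
    (alpha j ^+ twins_opposite T j * beta j ^+ twins_same T j).
suff cvT : forall T, (tau0 P (fun j => normalized (x j)) T : nat -> R[i]^o) @ \oo -->
    (limit T : R[i]^o).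
  by split=> // T; apply/cvg_ex; exists (limit T).
move=> T; rewrite /limit; case: asboolP => [cT|ncT].
  rewrite mul1r (fsbigE (labels T)) ?undup_uniq//=; last first.
    move=> j _; rewrite mem_undup => jT.
    have no_pair (o : rel (tg_edge T)) : twin_pairs o j = finset.set0.
      apply/finset.setP => q; rewrite !inE; apply/negbTE/negP => /existsP[e /existsP[e']].
      move=> /and5P[_ _ _ /eqP le _]; move/negP: jT; apply.
      by rewrite -le map_f// mem_enum.
    by rewrite /twins_opposite /twins_same -/(twin_pairs _ j) -/(twin_pairs _ j)
      !no_pair cards0 !expr0 mulr1.
  under eq_bigl do rewrite in_setT.
  exact: tau0_colored_double_tree.
rewrite mul0r; case: (pselect (exists2 q, q \in blocks T & (#|q| <= 1)%N)).
  by move=> [q qT q1]; apply: tau0_singleton_block qT q1.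
move=> no_singleton; apply: tau0_degenerate => // EV.
apply: ncT; apply: blocks_colored_double_tree => // q qT.
by rewrite ltnNge; apply/negP => q1; apply: no_singleton; exists q.
Qed.
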